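(* There exist absolute constants $c_1,c_2$ such that the following holds. Let $\theta:\mathbf{R}^K_+\to\mathbf{R}$ be convex, continuous, positive outside of the origin, positively homogeneous of degree 1, and monotone on $\mathbf{R}^K_+$ ($0\le t\le t'$ implies $\theta(t)\le\theta(t')$); let $\mathcal{T}=\{t\in\mathbf{R}^K_+:\theta(t)\le 1\}$, and let $P\in\mathbf{R}^{p\times n}$ with $\mathrm{Rank}(P)=p$. (i) Let $T_1,\ldots,T_K$ be symmetric positive semidefinite $n\times n$ matrices with $\sum_iT_i$ positive definite, let $$\mathcal{X}=\{x\in\mathbf{R}^n:\exists t\in\mathcal{T}:\ x^TT_ix\le t_i,\ 1\le i\le K\},\qquad \|x\|_{\mathcal{X}}=\theta^{1/2}\big([\|T_1^{1/2}x\|_2^2;\ldots;\|T_K^{1/2}x\|_2^2]\big),$$ and let $\overline{\mathcal{X}}=P\mathcal{X}$ be the corresponding ellitope. Then the ellitopic norm $\|u\|_{\overline{\mathcal{X}}}=\min_x\{\|x\|_{\mathcal{X}}:Px=u\}$ on $\mathbf{R}^p$ is $(c_1\ln(K+1),c_2)$-regular. (ii) For $1\le i\le K$ let $S_i[x]=\sum_{j=1}^nx_jS^{ij}$ with $S^{ij}\in\mathbf{S}^{d_i}$, be such that $S_i[x]=0$ for all $i\le K$ if and only if $x=0$; let $$\mathcal{X}=\{x\in\mathbf{R}^n:\exists t\in\mathcal{T}:\ S_i^2[x]\preceq t_iI_{d_i},\ 1\le i\le K\},\qquad \|x\|_{\mathcal{X}}=\theta^{1/2}\big([\|S_1[x]\|_{2,2}^2;\ldots;\|S_K[x]\|_{2,2}^2]\big),$$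 and let $\overline{\mathcal{X}}=P\mathcal{X}$ be the corresponding spectratope. Then the spectratopic norm $\|u\|_{\overline{\mathcal{X}}}=\min_x\{\|x\|_{\mathcal{X}}:Px=u\}$ on $\mathbf{R}^p$ is $(c_1[\ln(K+1)+\max_{i\le K}\ln(d_i)],c_2)$-regular.
   Context: For reals $\varkappa\ge 1$, a norm $\mathfrak{n}(\cdot)$ on $\mathbf{R}^n$ is called $\varkappa$-smooth if the function $\Phi(x)=\mathfrak{n}^2(x)$ is continuously differentiable and $\Phi(x+h)\le\Phi(x)+[\Phi'(x)]^Th+\varkappa\Phi(h)$ for all $x,h\in\mathbf{R}^n$. For reals $\varkappa\ge1,\varsigma\ge1$, a norm $\|\cdot\|$ on $\mathbf{R}^n$ is called $(\varkappa,\varsigma)$-regular if there exists a $\varkappa$-smooth norm $\mathfrak{n}(\cdot)$ on $\mathbf{R}^n$ such that $\varsigma^{-1}\mathfrak{n}(x)\le\|x\|\le\varsigma\,\mathfrak{n}(x)$ for all $x$. $\mathbf{S}^d$ is the space of real symmetric $d\times d$ matrices, $I_d$ the $d\times d$ identity; $A\preceq B$ means that $A,B$ are symmetric of the same size and $B-A$ is positive semidefinite; $S_i^2[x]$ is the square of the matrix $S_i[x]$; $\|\cdot\|_{2,2}$ is the spectral norm (maximal singular value) and $\|\cdot\|_2$ the Euclidean norm; $\mathbf{R}^K_+$ is the nonnegative orthant with entrywise inequalities; $P\mathcal{X}$ is the image of $\mathcal{X}$ under $x\mapsto Px$. In both cases $\|\cdot\|_{\mathcal{X}}$ is the norm on $\mathbf{R}^n$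 with unit ball $\mathcal{X}$, and $\|\cdot\|_{\overline{\mathcal{X}}}$ is the norm on $\mathbf{R}^p$ with unit ball $\overline{\mathcal{X}}$. ''Absolute constants'' do not depend on any of the data. *)

(* Defs.v *)
From HB Require Import structures.
From mathcomp Require Export all_boot all_order all_algebra.
From mathcomp Require Export all_classical all_reals all_analysis.

Set Implicit Arguments.
Unset Strict Implicit.
Unset Printing Implicit Defensive.

Import Order.TTheory GRing.Theory Num.Theory.
Import numFieldNormedType.Exports.

Local Open Scope classical_set_scope.
Local Open Scope ring_scope.

Section Norms.
Context {R : realType}.

Definition is_norm n (N : 'cV[R]_n -> R) : Prop :=
  [/\ forall x, 0 <= N x,
      forall x, N x = 0 -> x = 0,
      forall (a : R) x, N (a *: x) = `|a| * N x
    & forall x y, N (x + y) <= N x + N y].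

Definition norm_with_unit_ball n (N : 'cV[R]_n -> R) (B : set 'cV[R]_n) : Prop :=
  is_norm N /\ [set x | N x <= 1] = B.

Definition gradient n (f : 'cV[R]_n -> R) (x : 'cV[R]_n) : 'cV[R]_n :=
  \col_i 'D_(delta_mx i 0) f x.

(* The topology of 'cV[R]_n is that of the sup norm, hence the usual one: which
   functions are (continuously) differentiable does not depend on that norm. *)
Definition continuously_differentiable n (f : 'cV[R]_n -> R) : Prop :=
  (forall x, differentiable f x) /\ continuous (gradient f).

Definition smooth_norm n (kappa : R) (N : 'cV[R]_n -> R) : Prop :=
  let Phi := fun x => N x ^+ 2 in
  [/\ 1 <= kappa, is_norm N, continuously_differentiable Phi
    & forall x h,
        Phi (x + h) <= Phi x + ((gradient Phi x)^T *m h) 0 0 + kappa * Phi h].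

Definition regular_norm n (kappa sigma : R) (N : 'cV[R]_n -> R) : Prop :=
  [/\ 1 <= kappa, 1 <= sigma, is_norm N
    & exists2 M : 'cV[R]_n -> R, smooth_norm kappa M
        & forall x, sigma^-1 * M x <= N x /\ N x <= sigma * M x].

Definition euclidean_norm n (x : 'cV[R]_n) : R :=
  Num.sqrt (\sum_i x i 0 ^+ 2).

(* Maximal singular value: singular values of A are the square roots of the
   eigenvalues of A^T A.  This set is finite, and it is empty (with sup equal
   to 0) only when A has no columns. *)
Definition spectral_norm m n (A : 'M[R]_(m, n)) : R :=
  sup [set Num.sqrt l | l in [set l | eigenvalue (A^T *m A) l]].

Definition is_minimum (A : set R) (m : R) : Prop := A m /\ lbound A m.

End Norms.

Section Matrices.
Context {R : realType}.

Definition possemidef n (A : 'M[R]_n) : Prop :=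
  A \is symmetricmx /\ forall x : 'cV[R]_n, 0 <= (x^T *m A *m x) 0 0.

Definition posdef n (A : 'M[R]_n) : Prop :=
  A \is symmetricmx /\
  forall x : 'cV[R]_n, x != 0 -> 0 < (x^T *m A *m x) 0 0.

Definition loewner_le n (A B : 'M[R]_n) : Prop :=
  [/\ A \is symmetricmx, B \is symmetricmx & possemidef (B - A)].

(* A^{1/2}: the positive semidefinite square root; for A positive semidefinite
   it exists and is unique, so the default value 0 is never used. *)
Definition sqrtmx n (A : 'M[R]_n) : 'M[R]_n :=
  xget 0 [set B : 'M[R]_n | possemidef B /\ B *m B = A].

End Matrices.

Section Bodies.
Context {R : realType}.

Definition orthant K : set 'cV[R]_K := [set t | forall i, 0 <= t i 0].

(* theta is a total function, of which only the values on the orthant matter. *)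
Record monotone_gauge K (theta : 'cV[R]_K -> R) : Prop := MonotoneGauge {
  gauge_convex : convex_function (@orthant K) theta;
  gauge_continuous : {within @orthant K, continuous theta};
  gauge_pos : forall t, orthant t -> t != 0 -> 0 < theta t;
  gauge_homo : forall (a : R) t, 0 <= a -> orthant t ->
    theta (a *: t) = a * theta t;
  gauge_monotone : forall t t' : 'cV[R]_K, (forall i, 0 <= t i 0 <= t' i 0) ->
    theta t <= theta t' }.

Definition gauge_body K (theta : 'cV[R]_K -> R) : set 'cV[R]_K :=
  [set t | orthant t /\ theta t <= 1].

Definition basic_ellitope K n (theta : 'cV[R]_K -> R) (T : 'I_K -> 'M[R]_n) :
    set 'cV[R]_n :=
  [set x | exists2 t, gauge_body theta t
         & forall i, (x^T *m T i *m x) 0 0 <= t i 0].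

Definition basic_ellitopic_norm K n (theta : 'cV[R]_K -> R)
    (T : 'I_K -> 'M[R]_n) (x : 'cV[R]_n) : R :=
  Num.sqrt (theta (\col_i euclidean_norm (sqrtmx (T i) *m x) ^+ 2)).

Definition linear_matrix n d (S : 'I_n -> 'M[R]_d) (x : 'cV[R]_n) : 'M[R]_d :=
  \sum_j x j 0 *: S j.

Definition basic_spectratope K n (theta : 'cV[R]_K -> R) (d : 'I_K -> nat)
    (S : forall i : 'I_K, 'I_n -> 'M[R]_(d i)) : set 'cV[R]_n :=
  [set x | exists2 t, gauge_body theta t
         & forall i, loewner_le (linear_matrix (S i) x *m linear_matrix (S i) x)
                                (t i 0)%:M].

Definition basic_spectratopic_norm K n (theta : 'cV[R]_K -> R)
    (d : 'I_K -> nat) (S : forall i : 'I_K, 'I_n -> 'M[R]_(d i))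
    (x : 'cV[R]_n) : R :=
  Num.sqrt (theta (\col_i spectral_norm (linear_matrix (S i) x) ^+ 2)).

Definition image_body p n (P : 'M[R]_(p, n)) (X : set 'cV[R]_n) :
    set 'cV[R]_p :=
  [set P *m x | x in X].

Definition fiber_values p n (P : 'M[R]_(p, n)) (N : 'cV[R]_n -> R)
    (u : 'cV[R]_p) : set R :=
  [set N x | x in [set x | P *m x = u]].

Definition image_norm p n (P : 'M[R]_(p, n)) (N : 'cV[R]_n -> R)
    (u : 'cV[R]_p) : R :=
  inf (fiber_values P N u).

(* For K >= 1 and sizes d i >= 1 the logarithms are nonnegative, so the initial
   value 0 of the iterated maximum is harmless. *)
Definition max_ln K (d : 'I_K -> nat) : R :=
  \big[Num.max/0]_(i < K) ln (d i)%:R.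

End Bodies.

(* Main.v *)
From HB Require Import structures.
Require Import Defs.
From mathcomp Require Import ring lra zify.

Set Implicit Arguments.
Unset Strict Implicit.
Unset Printing Implicit Defensive.

Import Order.TTheory GRing.Theory Num.Theory.
Import numFieldNormedType.Exports.

Local Open Scope classical_set_scope.
Local Open Scope ring_scope.

(** Both norms have the form sqrt (theta (Z_1 x, .., Z_K x)) for squares Z_i of
seminorms: Z_i x = x^T T_i x for an ellitope, Z_i x = |S_i[x]|^2 (spectral norm)
for a spectratope.  The task is to replace Z_i and theta by smoother objects,
losing only absolute constants.

It is convenient to measure smoothness of a square F of a norm by the symmetric
inequality F (x + h) + F (x - h) <= 2 (F x + kappa F h) (uniformly_smooth).
It passes to images under P, by adding and subtracting minimizers
(image_norm_smooth).  It also implies kappa-smoothness up to a factor 2: since F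
is convex, its one-sided derivative in the direction h is sublinear in h; the
inequality makes it odd, hence linear, and it is then a gradient satisfying the
required quadratic upper bound, which moreover forces it to be Lipschitz
(uniformly_smooth_norm).

The gauge theta is replaced, for q = k + 1 with 2^q >= K, by the envelope
  psi(y) = inf { theta(t) + sum_i theta(e_i) w_i : t, w >= 0, y_i^q <= w_i t_i^k }.
As y <= t + w for feasible (t, w), and t = 2 y, w = y / 2^k is feasible,
theta <= psi <= 4 theta.  The minimal w_i is y_i^q / t_i^k, which is jointly
convex and homogeneous of degree 1 in (y_i, t_i); this turns the coordinatewise
inequality u_i^q + v_i^q <= 2 (a y_i + b y'_i)^q into
psi(u) + psi(v) <= 2 (a psi(y) + b psi(y')) (envelope_avg).  Hence psi of
(Y_1 x, .., Y_K x) is uniformly smooth with constant kappa as soon as each Y_i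
satisfies Y (x + h)^q + Y (x - h)^q <= 2 (Y x + kappa Y h)^q (pow_smooth), with an
exponent q which is logarithmic in K.

For a semidefinite quadratic form, pow_smooth holds with kappa = 4 q by a scalar
two-point inequality (two_point_pow).  For a spectratope, Y_i is the square of the
Schatten norm of order 2 q of S_i[x], comparable with the square of the spectral
norm as soon as 2^q >= d_i.  There one expands the traces of (X + H)^(2q) and
(X - H)^(2q) into words in X and H.  By Cauchy-Schwarz and cyclicity of the trace,
the trace of a word is at most the product of the Schatten norms of its letters
(word_trace_le), and this reduces the claim to the same scalar inequality.

All this gives the constant 8 q, with q of the order of
ln (K + 1) + max_i ln d_i. *)

(** * Convex 2-homogeneous functions and monotone gauges *)

Section SquareGauges.
Context {R : realType} {n : nat}.
Implicit Types (F N : 'cV[R]_n -> R) (x y : 'cV[R]_n).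

(** These are exactly the squares of seminorms; convexity of the square is easier
to transport through theta and the envelope than the triangle inequality. *)
Record square_gauge F : Prop := SquareGauge {
  square_gauge_ge0 : forall x, 0 <= F x;
  square_gaugeZ : forall a x, F (a *: x) = a ^+ 2 * F x;
  square_gauge_convex : forall a b x y, 0 <= a -> 0 <= b -> a + b = 1 ->
    F (a *: x + b *: y) <= a * F x + b * F y }.

(** With a > sqrt (F x) and b > sqrt (F y), the vector (x + y) / (a + b) is a
convex combination of x / a and y / b, where F is at most 1. *)
Lemma sqrt_square_gaugeD F x y : square_gauge F ->
  Num.sqrt (F (x + y)) <= Num.sqrt (F x) + Num.sqrt (F y).
Proof.
move=> gF; apply/ler_addgt0Pr => e e0.
set a := Num.sqrt (F x) + e / 2; set b := Num.sqrt (F y) + e / 2.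
have a0 : 0 < a by rewrite ltr_wpDl ?sqrtr_ge0 ?divr_gt0.
have b0 : 0 < b by rewrite ltr_wpDl ?sqrtr_ge0 ?divr_gt0.
have ab0 : 0 < a + b by rewrite addr_gt0.
have Fa z c : 0 < c -> Num.sqrt (F z) <= c -> F (c^-1 *: z) <= 1.
  move=> c0 Fc; rewrite (square_gaugeZ gF) exprVn ler_pdivrMl ?exprn_gt0 // mulr1.
  by rewrite -(sqr_sqrtr (square_gauge_ge0 gF z)) lerXn2r // ?nnegrE ?sqrtr_ge0
    ?(ltW c0).
have -> : Num.sqrt (F x) + Num.sqrt (F y) + e = a + b by rewrite /a /b; field.
rewrite -[leRHS](gtr0_norm ab0) -sqrtr_sqr ler_wsqrtr //.
have -> : x + y = (a + b) *:
    ((a / (a + b)) *: (a^-1 *: x) + (b / (a + b)) *: (b^-1 *: y)).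
  have an : a != 0 by rewrite gt_eqF.
  have bn : b != 0 by rewrite gt_eqF.
  have abn : a + b != 0 by rewrite gt_eqF.
  rewrite scalerDr !scalerA.
  have -> : (a + b) * (a / (a + b)) * a^-1 = 1 by field; rewrite ?an ?bn abn.
  have -> : (a + b) * (b / (a + b)) * b^-1 = 1 by field; rewrite ?an ?bn abn.
  by rewrite !scale1r.
rewrite (square_gaugeZ gF) ler_piMr ?sqr_ge0 //.
apply: le_trans (square_gauge_convex gF _ _ _ _ _) _.
- by rewrite divr_ge0 ?ltW.
- by rewrite divr_ge0 ?ltW.
- by rewrite -mulrDl divff // gt_eqF.
have -> : 1 = a / (a + b) * 1 + b / (a + b) * 1 :> R.
  by rewrite !mulr1 -mulrDl divff // gt_eqF.
rewrite lerD // ler_wpM2l ?divr_ge0 ?(ltW a0) ?(ltW b0) ?(ltW ab0) // Fa //.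
  by rewrite /a lerDl ltW // divr_gt0.
by rewrite /b lerDl ltW // divr_gt0.
Qed.

Lemma sqrt_square_gauge_norm F : square_gauge F -> (forall x, F x = 0 -> x = 0) ->
  is_norm (fun x => Num.sqrt (F x)).
Proof.
move=> gF F0; split.
- by move=> x; exact: sqrtr_ge0.
- move=> x /eqP; rewrite sqrtr_eq0 => Fx; apply: F0; apply/eqP.
  by rewrite eq_le Fx (square_gauge_ge0 gF).
- by move=> a x; rewrite (square_gaugeZ gF) sqrtrM ?sqr_ge0 // sqrtr_sqr.
- by move=> x y; exact: sqrt_square_gaugeD.
Qed.

Lemma seminorm_square_gauge N : (forall x, 0 <= N x) ->
  (forall a x, N (a *: x) = `|a| * N x) ->
  (forall x y, N (x + y) <= N x + N y) ->
  square_gauge (fun x => N x ^+ 2).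
Proof.
move=> N0 NZ ND; split.
- by move=> x; exact: sqr_ge0.
- by move=> a x; rewrite NZ exprMn real_normK // num_real.
move=> a b x y a0 b0 ab; apply: (@le_trans _ _ ((a * N x + b * N y) ^+ 2)).
  rewrite lerXn2r ?nnegrE ?addr_ge0 ?mulr_ge0 //.
  by apply: le_trans (ND _ _) _; rewrite !NZ !ger0_norm.
have -> : b = 1 - a by rewrite -ab addrC addKr.
rewrite -subr_ge0.
set u := N x; set v := N y.
have -> : a * u ^+ 2 + (1 - a) * v ^+ 2 - (a * u + (1 - a) * v) ^+ 2 =
    a * b * (u - v) ^+ 2.
  by rewrite (_ : b = 1 - a); [ring | rewrite -ab addrC addKr].
by rewrite mulr_ge0 ?sqr_ge0 // mulr_ge0.
Qed.

End SquareGauges.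

Section MonotoneGauges.
Context {R : realType} {K : nat} (theta : 'cV[R]_K -> R).
Hypothesis gtheta : monotone_gauge theta.
Implicit Types s t : 'cV[R]_K.

Lemma orthantD s t : orthant s -> orthant t -> orthant (s + t).
Proof. by move=> s0 t0 i; rewrite mxE addr_ge0. Qed.

Lemma orthantZ a t : 0 <= a -> orthant t -> orthant (a *: t).
Proof. by move=> a0 t0 i; rewrite mxE mulr_ge0. Qed.

Lemma orthant_delta i : orthant (delta_mx i 0 : 'cV[R]_K).
Proof. by move=> j; rewrite mxE ler0n. Qed.

Lemma orthant0 : orthant (0 : 'cV[R]_K).
Proof. by move=> j; rewrite mxE. Qed.

Lemma gauge0 : theta 0 = 0.
Proof. by rewrite -(scale0r 0) (gauge_homo gtheta) ?mul0r //; exact: orthant0. Qed.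

Lemma gauge_ge0 t : orthant t -> 0 <= theta t.
Proof.
move=> t0; rewrite -gauge0; apply: (gauge_monotone gtheta) => i.
by rewrite mxE lexx t0.
Qed.

Lemma gaugeD s t : orthant s -> orthant t -> theta (s + t) <= theta s + theta t.
Proof.
move=> s0 t0.
have h0 : (0 : R) <= 2^-1 by rewrite invr_ge0.
have h1 : (2^-1 : R) <= 1 by rewrite invf_le1 // ler1n.
pose h : {i01 R} := Itv01 h0 h1.
have := gauge_convex gtheta h (mem_set (orthantZ (ler0n R 2) s0))
  (mem_set (orthantZ (ler0n R 2) t0)).
rewrite convRE /conv /= /unstable.onem.
have -> : 1 - 2^-1 = 2^-1 :> R by field.
rewrite !scalerA mulVf ?pnatr_eq0 // !scale1r.
by rewrite !(gauge_homo gtheta) // !mulrA mulVf ?pnatr_eq0 // !mul1r.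
Qed.

Lemma gauge_sum (I : Type) (r : seq I) (f : I -> 'cV[R]_K) :
  (forall i, orthant (f i)) -> theta (\sum_(i <- r) f i) <= \sum_(i <- r) theta (f i).
Proof.
move=> f0; elim: r => [|i r IH]; first by rewrite !big_nil gauge0.
rewrite !big_cons; apply: le_trans (gaugeD _ _) _ => //; last by rewrite lerD2l.
by elim/big_ind: _ => //; [exact: orthant0 | exact: orthantD].
Qed.

(** The gauge lies between its values on the single coordinates (gauge_coord) and
their sum; the weights theta (e_i) of the envelope come from these two bounds. *)
Lemma gauge_le_sum t : orthant t ->
  theta t <= \sum_i theta (delta_mx i 0) * t i 0.
Proof.
move=> t0.
have {1}-> : t = \sum_i t i 0 *: delta_mx i 0.
  by rewrite {1}[t]matrix_sum_delta; apply: eq_bigr => i _; rewrite big_ord1.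
apply: le_trans (gauge_sum _ _) _ => [i|]; first exact: orthantZ (t0 i) (orthant_delta i).
apply: ler_sum => i _; rewrite (gauge_homo gtheta) // 1?mulrC //.
exact: orthant_delta.
Qed.

Lemma gauge_coord t i : orthant t -> theta (delta_mx i 0) * t i 0 <= theta t.
Proof.
move=> t0; rewrite mulrC -(gauge_homo gtheta) //; last exact: orthant_delta.
apply: (gauge_monotone gtheta) => j; rewrite !mxE eqxx andbT.
by case: eqP => [->|_]; rewrite ?mulr1 ?mulr0 ?lexx ?t0.
Qed.

Lemma gauge_eq0 t : orthant t -> theta t = 0 -> t = 0.
Proof.
move=> t0 tt; apply/eqP/negPn/negP => tn.
by have := gauge_pos gtheta t0 tn; rewrite tt ltxx.
Qed.

Lemma square_gauge_comp n (Y : 'I_K -> 'cV[R]_n -> R) :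
  (forall i, square_gauge (Y i)) -> square_gauge (fun x => theta (\col_i Y i x)).
Proof.
move=> gY.
have Y0 x : orthant (\col_i Y i x) by move=> i; rewrite mxE (square_gauge_ge0 (gY i)).
split.
- by move=> x; exact: gauge_ge0.
- move=> a x; rewrite -(gauge_homo gtheta) ?sqr_ge0 //; congr theta.
  by apply/colP => i; rewrite !mxE (square_gaugeZ (gY i)).
- move=> a b x y a0 b0 ab.
  rewrite -!(gauge_homo gtheta) //.
  apply: le_trans (gaugeD (orthantZ a0 (Y0 x)) (orthantZ b0 (Y0 y))).
  apply: (gauge_monotone gtheta) => i; rewrite !mxE.
  by rewrite (square_gauge_ge0 (gY i)) (square_gauge_convex (gY i)).
Qed.

End MonotoneGauges.

(** * Scalar inequalities *)
Section ScalarInequalities.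
Context {R : realFieldType}.

(** With A = X + H, put P_m and Q_m for the sum and the difference of the m-th
powers of A + 2 z and A - 2 z, so that P_(m+1) = A P_m + 2 z Q_m and
z Q_(m+1) = A (z Q_m) + 2 z^2 P_m.  The second recursion yields
z Q_m <= 2 m H P_m, and then the first one lets P grow at each step by a factor of
at most X + (1 + 4 m) H. *)
Lemma two_point_pow (q : nat) (X H z : R) : 0 <= X -> 0 <= H -> z ^+ 2 <= X * H ->
  (X + H + 2 * z) ^+ q + (X + H - 2 * z) ^+ q <= 2 * (X + 4 * q%:R * H) ^+ q.
Proof.
move=> X0 H0 zXH; set A := X + H.
have A0 : 0 <= A by rewrite addr_ge0.
pose P m := (A + 2 * z) ^+ m + (A - 2 * z) ^+ m.
pose zQ m := z * ((A + 2 * z) ^+ m - (A - 2 * z) ^+ m).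
have PS m : P m.+1 = A * P m + 2 * zQ m by rewrite /P /zQ !exprS; ring.
have QS m : zQ m.+1 = A * zQ m + 2 * z ^+ 2 * P m by rewrite /P /zQ !exprS; ring.
have PQ m : [/\ 0 <= P m, 0 <= zQ m & zQ m <= 2 * m%:R * H * P m].
  elim: m => [|m [IP IQ IPQ]].
    by rewrite /P /zQ !expr0 subrr mulr0 mulr0 !mul0r lexx addr_ge0.
  have zP : 2 * z ^+ 2 * P m <= 2 * H * A * P m.
    rewrite ler_wpM2r // -!mulrA ler_wpM2l // (le_trans zXH) //.
    rewrite [X * H]mulrC ler_wpM2l //.
    by rewrite /A lerDl.
  rewrite PS QS; split.
  - exact: addr_ge0 (mulr_ge0 A0 IP) (mulr_ge0 (ler0n _ 2) IQ).
  - exact: addr_ge0 (mulr_ge0 A0 IQ) (mulr_ge0 (mulr_ge0 (ler0n _ 2) (sqr_ge0 z)) IP).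
  - have h1 : A * zQ m <= A * (2 * m%:R * H * P m) by rewrite ler_wpM2l.
    have h2 : 0 <= 2 * m.+1%:R * H * (2 * zQ m).
      by apply: mulr_ge0 (mulr_ge0 (ler0n _ 2) IQ); rewrite !mulr_ge0.
    rewrite [leRHS]mulrDr; apply: le_trans (lerD h1 zP) _.
    apply: le_trans (_ : _ <= 2 * m.+1%:R * H * (A * P m)) _; last by rewrite lerDl.
    by rewrite -[m.+1]addn1 natrD le_eqVlt; apply/orP; left; apply/eqP; ring.
suff h m : (m <= q)%N -> P m <= 2 * (X + 4 * q%:R * H) ^+ m by exact: h.
elim: m => [_|m IH mq]; first by rewrite /P !expr0 mulr1.
have [P0 Q0 PQm] := PQ m.
rewrite PS; apply: le_trans (_ : _ <= (X + 4 * q%:R * H) * P m) _; last first.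
  rewrite exprS mulrCA ler_wpM2l ?IH ?(ltnW mq) //.
  by rewrite addr_ge0 ?mulr_ge0.
have h1 : 2 * zQ m <= 4 * m%:R * H * P m.
  apply: le_trans (ler_wpM2l _ PQm) _ => //.
  by rewrite le_eqVlt; apply/orP; left; apply/eqP; ring.
apply: le_trans (lerD (lexx _) h1) _.
rewrite -mulrDl ler_wpM2r // /A -addrA lerD2l.
rewrite -[leLHS](_ : (1 + 4 * m%:R) * H = _); last by ring.
rewrite ler_wpM2r //.
have : m.+1%:R <= q%:R :> R by rewrite ler_nat.
rewrite -[m.+1]addn1 natrD => ?; lra.
Qed.

Lemma two_point_pow_sum (q : nat) (x h : R) : 0 <= x -> 0 <= h ->
  (x + h) ^+ (q + q) + (x - h) ^+ (q + q) <=
  2 * (x ^+ 2 + 4 * q%:R * h ^+ 2) ^+ q.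
Proof.
move=> x0 h0; have xh : (x * h) ^+ 2 <= x ^+ 2 * h ^+ 2 by rewrite exprMn.
have := two_point_pow q (sqr_ge0 x) (sqr_ge0 h) xh.
have -> : x ^+ 2 + h ^+ 2 + 2 * (x * h) = (x + h) ^+ 2 by ring.
have -> : x ^+ 2 + h ^+ 2 - 2 * (x * h) = (x - h) ^+ 2 by ring.
by rewrite -!exprM mul2n addnn.
Qed.

Lemma pow_tangent (k : nat) (a m : R) : 0 <= a -> 0 <= m ->
  m ^+ k.+1 + k.+1%:R * m ^+ k * (a - m) <= a ^+ k.+1.
Proof.
move=> a0 m0; elim: k => [|k IH]; first by rewrite !expr1 expr0 !mul1r addrC subrK.
rewrite (exprS a); apply: le_trans (ler_wpM2l a0 IH).
rewrite -subr_ge0.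
have -> : a * (m ^+ k.+1 + k.+1%:R * m ^+ k * (a - m))
    - (m ^+ k.+2 + k.+2%:R * m ^+ k.+1 * (a - m)) = k.+1%:R * m ^+ k * (a - m) ^+ 2.
  by rewrite !exprS -[k.+2]addn1 natrD; ring.
by rewrite mulr_ge0 ?sqr_ge0 // mulr_ge0 // exprn_ge0.
Qed.

(** Superadditivity of the weighted geometric mean of w and t, or equivalently
subadditivity of the perspective (y, t) |-> y^(k+1) / t^k.  It follows by adding
the tangents of the power function at the common slope
m = (y + y') / (t + t'); the form without division allows t = 0. *)
Lemma pow_perspectiveD (k : nat) (y y' w w' t t' : R) : (0 < k)%N ->
  0 <= y -> 0 <= y' -> 0 <= w -> 0 <= w' -> 0 <= t -> 0 <= t' ->
  y ^+ k.+1 <= w * t ^+ k -> y' ^+ k.+1 <= w' * t' ^+ k ->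
  (y + y') ^+ k.+1 <= (w + w') * (t + t') ^+ k.
Proof.
move=> k0 y0 y'0 w0 w'0 t0 t'0 h h'.
have H0 (a b : R) : 0 <= a -> a ^+ k.+1 <= b * 0 ^+ k -> a = 0.
  move=> a0; rewrite expr0n gtn_eqF // mulr0 => ha; apply/eqP.
  by have : a ^+ k.+1 == 0; [rewrite eq_le ha exprn_ge0 | rewrite expf_eq0].
have [tz|tn] := eqVneq t 0.
  move: h; rewrite tz => /(H0 _ _ y0) ->; rewrite !add0r.
  by apply: le_trans h' _; rewrite ler_wpM2r ?exprn_ge0 // lerDr.
have [t'z|t'n] := eqVneq t' 0.
  move: h'; rewrite t'z => /(H0 _ _ y'0) ->; rewrite !addr0.
  by apply: le_trans h _; rewrite ler_wpM2r ?exprn_ge0 // lerDl.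
have {t0}t0 : 0 < t by rewrite lt_neqAle eq_sym tn.
have {t'0}t'0 : 0 < t' by rewrite lt_neqAle eq_sym t'n.
have T0 : 0 < t + t' by rewrite addr_gt0.
have Tn : t + t' != 0 by rewrite gt_eqF.
pose m := (y + y') / (t + t').
have m0 : 0 <= m by rewrite divr_ge0 ?addr_ge0 ?(ltW t0) ?(ltW t'0).
have w_ge a b c : 0 < c -> 0 <= a -> a ^+ k.+1 <= b * c ^+ k ->
    c * m ^+ k.+1 + k.+1%:R * m ^+ k * (a - c * m) <= b.
  move=> c0 a0 hb.
  have := ler_wpM2l (ltW c0) (pow_tangent k (divr_ge0 a0 (ltW c0)) m0).
  have -> : c * (m ^+ k.+1 + k.+1%:R * m ^+ k * (a / c - m)) =
            c * m ^+ k.+1 + k.+1%:R * m ^+ k * (a - c * m).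
    by field; rewrite gt_eqF.
  move=> /le_trans; apply.
  rewrite expr_div_n mulrA ler_pdivrMr ?exprn_gt0 // [c ^+ _]exprS mulrCA.
  by rewrite ler_wpM2l ?(ltW c0).
have e : y + y' = (t + t') * m by rewrite /m mulrC divfK.
rewrite e exprMn exprS mulrAC ler_wpM2r ?exprn_ge0 ?(ltW T0) //.
apply: le_trans (lerD (w_ge _ _ _ t0 y0 h) (w_ge _ _ _ t'0 y'0 h')).
rewrite addrACA -mulrDl -mulrDr addrACA -opprD -mulrDl e subrr mulr0 addr0.
by [].
Qed.

End ScalarInequalities.

(** * The smooth envelope of a monotone gauge *)
Lemma le_mul_inf {R : realType} (A : set R) (a c : R) : 0 <= a -> A !=set0 ->
  (forall r, A r -> c <= a * r) -> c <= a * inf A.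
Proof.
move=> a0 [r0 Ar0] h; have [az|an] := eqVneq a 0.
  by move: (h _ Ar0); rewrite az !mul0r.
have ap : 0 < a by rewrite lt_neqAle eq_sym an.
rewrite -ler_pdivrMl //; apply: lb_le_inf; first by exists r0.
by move=> r Ar; rewrite ler_pdivrMl // h.
Qed.

Section Envelope.
Context {R : realType} {K : nat} (theta : 'cV[R]_K -> R) (k : nat).
Hypotheses (gtheta : monotone_gauge theta) (k_gt0 : (0 < k)%N).
Implicit Types s t u v w y : 'cV[R]_K.

Definition envelope_cost t w : R :=
  theta t + \sum_i theta (delta_mx i 0) * w i 0.

(** The constraint y_i^(k+1) <= w_i t_i^k makes w_i a majorant of
y_i^(k+1) / t_i^k, and forces y_i = 0 where t_i = 0. *)
Definition envelope_values y : set R :=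
  [set r | exists t w, [/\ orthant t, orthant w,
     forall i, y i 0 ^+ k.+1 <= w i 0 * t i 0 ^+ k & r = envelope_cost t w]].

Definition envelope y : R := inf (envelope_values y).

Lemma envelope_values_scaled y : orthant y ->
  envelope_values y (envelope_cost (2 *: y) ((2 ^+ k)^-1 *: y)).
Proof.
move=> y0; exists (2 *: y), ((2 ^+ k)^-1 *: y); split=> //.
- exact: orthantZ.
- by apply: orthantZ => //; rewrite invr_ge0 exprn_ge0.
move=> i; rewrite !mxE exprMn mulrACA mulVf ?expf_neq0 ?pnatr_eq0 // mul1r.
by rewrite exprS.
Qed.

Lemma envelope_values_neq0 y : orthant y -> envelope_values y !=set0.
Proof. by move=> y0; eexists; exact: envelope_values_scaled. Qed.

(** A feasible pair satisfies y <= max t w <= t + w coordinatewise. *)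
Lemma envelope_values_ge y r : orthant y -> envelope_values y r -> theta y <= r.
Proof.
move=> y0 [t [w [t0 w0 yw ->]]]; rewrite /envelope_cost.
apply: le_trans (lerD (lexx _) (gauge_le_sum gtheta w0)).
apply: le_trans (gaugeD gtheta t0 w0); apply: (gauge_monotone gtheta) => i.
rewrite y0 !mxE -(@ler_pXn2r _ k.+1) ?nnegrE ?addr_ge0 //.
apply: le_trans (yw i) _; rewrite exprS ler_pM ?exprn_ge0 //.
  by rewrite lerDr.
by rewrite lerXn2r ?nnegrE ?addr_ge0 // lerDl.
Qed.

Lemma envelope_le y r : orthant y -> envelope_values y r -> envelope y <= r.
Proof.
by move=> y0; apply: ge_inf; exists (theta y) => ? /(envelope_values_ge y0).
Qed.

Lemma envelope_ge y : orthant y -> theta y <= envelope y.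
Proof.
move=> y0; apply: lb_le_inf; first exact: envelope_values_neq0.
by move=> r /(envelope_values_ge y0).
Qed.

(** For t = 2 y and w = y / 2^k each of the K terms theta (e_i) w_i is at most
theta y / 2^k, so that their sum is at most 2 theta y. *)
Lemma envelope_le4 y : orthant y -> (K <= 2 ^ k.+1)%N ->
  envelope y <= 4 * theta y.
Proof.
move=> y0 Kk; apply: le_trans (envelope_le y0 (envelope_values_scaled y0)) _.
rewrite /envelope_cost (gauge_homo gtheta) //.
have -> : 4 * theta y = 2 * theta y + 2 * theta y by ring.
rewrite lerD2l; apply: (@le_trans _ _ (\sum_(i < K) (2 ^+ k)^-1 * theta y)).
  apply: ler_sum => i _; rewrite mxE mulrCA ler_wpM2l ?invr_ge0 ?exprn_ge0 //.
  exact: gauge_coord.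
rewrite sumr_const card_ord -mulrnAl ler_wpM2r ?gauge_ge0 //.
rewrite -[leLHS]mulr_natr ler_pdivrMl ?exprn_gt0 //.
by rewrite -exprSr -natrX ler_nat.
Qed.

(** If (t, w) and (t', w') are feasible for y and y', then T = a t + b t' and
W = a w + b w' are feasible for a y + b y'.  The same T serves for u and for v,
with w-parts u_i^(k+1) / T_i^k and v_i^(k+1) / T_i^k, whose sum is at
most 2 W_i by hypothesis. *)
Lemma envelope_avg (a b : R) u v y y' : 0 <= a -> 0 <= b ->
  orthant u -> orthant v -> orthant y -> orthant y' ->
  (forall i, u i 0 ^+ k.+1 + v i 0 ^+ k.+1 <=
     2 * (a * y i 0 + b * y' i 0) ^+ k.+1) ->
  envelope u + envelope v <= 2 * (a * envelope y + b * envelope y').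
Proof.
move=> a0 b0 u0 v0 y0 y'0 huv.
rewrite mulrDr !mulrA -lerBlDr; apply: (@le_mul_inf _ (envelope_values y)) => [||r].
- by rewrite mulr_ge0.
- exact: envelope_values_neq0.
move=> [t [w [t0 w0 yw ->]]].
rewrite lerBlDl -lerBlDr; apply: (@le_mul_inf _ (envelope_values y')) => [||r'].
- by rewrite mulr_ge0.
- exact: envelope_values_neq0.
move=> [t' [w' [t'0 w'0 yw' ->]]]; rewrite lerBlDl.
set T := a *: t + b *: t'; set W := a *: w + b *: w'.
have T0 : orthant T by apply: orthantD; exact: orthantZ.
have W0 : orthant W by apply: orthantD; exact: orthantZ.
have powW i : (a * y i 0 + b * y' i 0) ^+ k.+1 <= W i 0 * T i 0 ^+ k.
  rewrite !mxE; apply: pow_perspectiveD; rewrite ?mulr_ge0 //.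
  - by rewrite !exprMn [leRHS]mulrACA -exprS ler_wpM2l ?exprn_ge0.
  - by rewrite !exprMn [leRHS]mulrACA -exprS ler_wpM2l ?exprn_ge0.
pose share (z : 'cV[R]_K) : 'cV[R]_K := \col_i (z i 0 ^+ k.+1 / T i 0 ^+ k).
have share0 z : orthant z -> orthant (share z).
  by move=> z0 i; rewrite mxE divr_ge0 ?exprn_ge0.
have vanish i : T i 0 = 0 -> u i 0 ^+ k.+1 = 0 /\ v i 0 ^+ k.+1 = 0.
  move=> Ti; have := le_trans (huv i) (ler_wpM2l (ler0n _ 2) (powW i)).
  rewrite Ti expr0n gtn_eqF // !mulr0 => h.
  have up := exprn_ge0 k.+1 (u0 i); have vp := exprn_ge0 k.+1 (v0 i).
  split; lra.
have feasible z : orthant z -> (forall i, T i 0 = 0 -> z i 0 ^+ k.+1 = 0) ->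
    envelope z <= envelope_cost T (share z).
  move=> z0 zT; apply: envelope_le => //; exists T, (share z); split=> //.
    exact: share0.
  move=> i; rewrite mxE; have [Ti|Ti] := eqVneq (T i 0) 0.
    by rewrite zT // mul0r mul0r.
  by rewrite divfK // expf_neq0.
apply: le_trans (lerD (feasible u _ _) (feasible v _ _)) _ => //.
- by move=> i /vanish [].
- by move=> i /vanish [].
rewrite /envelope_cost addrACA.
have -> : 2 * a * (theta t + \sum_i theta (delta_mx i 0) * w i 0) +
    2 * b * (theta t' + \sum_i theta (delta_mx i 0) * w' i 0) =
    2 * (a * theta t + b * theta t') +
    2 * (\sum_i theta (delta_mx i 0) * W i 0).
  have -> : \sum_i theta (delta_mx i 0) * W i 0 =
      a * (\sum_i theta (delta_mx i 0) * w i 0) +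
      b * (\sum_i theta (delta_mx i 0) * w' i 0).
    rewrite !mulr_sumr -big_split /=; apply: eq_bigr => i _.
    by rewrite !mxE; ring.
  ring.
apply: lerD.
  have -> : theta T + theta T = 2 * theta T by ring.
  rewrite ler_wpM2l // /T.
  apply: le_trans (gaugeD gtheta _ _) _; try exact: orthantZ.
  by rewrite !(gauge_homo gtheta).
rewrite -big_split /= mulr_sumr; apply: ler_sum => i _.
rewrite -mulrDr mulrCA ler_wpM2l ?gauge_ge0 //; first exact: orthant_delta.
have shareE z : share z i 0 = z i 0 ^+ k.+1 / T i 0 ^+ k by rewrite mxE.
rewrite !shareE -mulrDl; have [Ti|Ti] := eqVneq (T i 0) 0.
  by have [-> ->] := vanish i Ti; rewrite addr0 mul0r mulr_ge0.
have Tp : 0 < T i 0 by rewrite lt_neqAle eq_sym Ti T0.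
rewrite ler_pdivrMr ?exprn_gt0 //.
by apply: le_trans (huv i) _; rewrite -mulrA ler_wpM2l.
Qed.

End Envelope.

(** * Norms on column vectors and their images *)
Section ColumnVectors.
Context {R : realType}.

Lemma ler_mxnorm m n (x : 'M[R]_(m, n)) c : 0 <= c ->
  (forall i j, `|x i j| <= c) -> `|x| <= c.
Proof.
move=> c0 xc; rewrite /Num.norm /= mx_normrE.
by apply/bigmax_leP; split=> //= ij _; exact: xc.
Qed.

Lemma entry_le_mxnorm m n (x : 'M[R]_(m, n)) i j : `|x i j| <= `|x|.
Proof.
rewrite [leRHS]/Num.norm /= mx_normrE; apply/bigmax_geP; right => /=.
by exists (i, j).
Qed.

Lemma lipschitz_continuous (V W : normedModType R) (f : V -> W) (C : R) :
  (forall x y, `|f x - f y| <= C * `|x - y|) -> continuous f.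
Proof.
move=> fC x; apply/cvgrPdist_lt => e e0; near=> y.
apply: le_lt_trans (fC x y) _; apply: (@le_lt_trans _ _ (`|C| * `|x - y|)).
  by rewrite ler_wpM2r // ler_norm.
rewrite -(@ltr_pM2l _ (`|C| + 1)^-1) ?invr_gt0 ?ltr_wpDl //.
rewrite mulrA; apply: (@le_lt_trans _ _ `|x - y|).
  rewrite ler_piMl // mulrC ler_pdivrMr ?ltr_wpDl // mul1r lerDl //.
by near: y; apply: cvgr_dist_lt => //; rewrite mulr_gt0 // invr_gt0 ltr_wpDl.
Unshelve. all: by end_near. Qed.

(** The Heine-Borel theorem for row vectors, transported by transposition. *)
Lemma bounded_closed_compact_cV n (A : set 'cV[R]_n) (c : R) :
  (forall x, A x -> `|x| <= c) -> closed A -> compact A.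
Proof.
move=> Ac clA.
have tr_le p q (x : 'M[R]_(p, q)) : `|x^T| <= `|x|.
  by apply: ler_mxnorm => // i j; rewrite mxE entry_le_mxnorm.
have tr_cont p q : continuous (@trmx R p q).
  by apply: (@lipschitz_continuous _ _ _ 1) => x y; rewrite mul1r -raddfB /= tr_le.
have -> : A = [set x^T | x in [set y : 'rV[R]_n | A y^T]].
  apply/seteqP; split=> [x Ax|_ [y Ay <-]] //.
  by exists x^T => //=; rewrite ?trmxK.
apply: continuous_compact; first by apply: continuous_subspaceT; exact: tr_cont.
apply: bounded_closed_compact.
  exists c; split; first exact: num_real.
  move=> M cM y /= /Ac yc; apply: le_trans (ltW cM).
  by apply: le_trans yc; rewrite -{1}[y]trmxK tr_le.
by apply: (preimage_closed (f := @trmx R 1 n) (D := A)) => // x _; exact: tr_cont.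
Qed.

End ColumnVectors.

Section NormsOnColumnVectors.
Context {R : realType} {n : nat} (N : 'cV[R]_n -> R).
Hypothesis nN : is_norm N.

Lemma is_norm_le_mxnorm : exists2 C : R, 0 < C & forall x, N x <= C * `|x|.
Proof.
have [N0 Ndef NZ ND] := nN.
exists (\sum_i N (delta_mx i 0) + 1); first by rewrite ltr_wpDl // sumr_ge0.
move=> x; have N00 : N 0 = 0 by rewrite -(scale0r 0) NZ normr0 mul0r.
have Nsum (r : seq 'I_n) (f : 'I_n -> 'cV[R]_n) :
    N (\sum_(i <- r) f i) <= \sum_(i <- r) N (f i).
  elim: r => [|i r IH]; first by rewrite !big_nil N00.
  by rewrite !big_cons; apply: le_trans (ND _ _) _; rewrite lerD2l.
have {1}-> : x = \sum_i x i 0 *: delta_mx i 0.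
  by rewrite {1}[x]matrix_sum_delta; apply: eq_bigr => i _; rewrite big_ord1.
apply: le_trans (Nsum _ _) _; rewrite mulrDl mulr_suml mul1r ler_wpDr //.
by apply: ler_sum => i _; rewrite NZ mulrC ler_wpM2l // entry_le_mxnorm.
Qed.

Lemma is_normN x : N (- x) = N x.
Proof. by have [_ _ NZ _] := nN; rewrite -scaleN1r NZ normrN1 mul1r. Qed.

Lemma is_norm_dist x y : `|N x - N y| <= N (x - y).
Proof.
have [N0 Ndef NZ ND] := nN; rewrite ler_norml; apply/andP; split.
  have := ND (y - x) x; rewrite subrK -opprB is_normN => h; lra.
by have := ND (x - y) y; rewrite subrK => h; lra.
Qed.

Lemma is_norm_continuous : continuous N.
Proof.
have [C C0 NC] := is_norm_le_mxnorm.
apply: (@lipschitz_continuous _ _ _ _ C) => x y.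
exact: le_trans (is_norm_dist x y) (NC _).
Qed.

(** A norm is continuous and attains a positive minimum on the compact sphere of
the sup norm. *)
Lemma is_norm_ge_mxnorm : exists2 c : R, 0 < c & forall x, c * `|x| <= N x.
Proof.
have [N0 Ndef NZ ND] := nN.
pose S := [set x : 'cV[R]_n | `|x| = 1].
have nZ x : x != 0 -> S (`|x|^-1 *: x).
  move=> x0; rewrite /S /= normrZ normfV normr_id mulVf // normr_eq0 //.
have [[x0 Sx0]|S0] := pselect (S !=set0); last first.
  exists 1 => // x; have [->|xn] := eqVneq x 0; first by rewrite normr0 mulr0.
  by case: S0; exists (`|x|^-1 *: x); exact: nZ.
have cS : compact S.
  apply: (@bounded_closed_compact_cV _ _ _ 1); first by move=> x ->.
  apply: (@preimage_closed _ _ (fun x : 'cV[R]_n => `|x|) [set 1]).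
    by move=> x _; exact: norm_continuous.
  exact: closed_eq.
have [||c /set_mem Sc cmin] := @compact_EVT_min _ R N S _ cS.
- by exists x0.
- by apply: continuous_subspaceT; exact: is_norm_continuous.
have Nc0 : 0 < N c.
  rewrite lt_neqAle N0 andbT eq_sym; apply/eqP => /Ndef c0.
  by move: Sc; rewrite /S /= c0 normr0 => /eqP; rewrite eq_sym oner_eq0.
exists (N c) => // x; have [->|xn] := eqVneq x 0; first by rewrite normr0 mulr0.
rewrite -ler_pdivlMr ?normr_gt0 // mulrC.
have -> : `|x|^-1 * N x = N (`|x|^-1 *: x) by rewrite NZ normfV normr_id.
by apply: cmin; apply/mem_set; exact: nZ.
Qed.

End NormsOnColumnVectors.

Section ImageNorms.
Context {R : realType} {p n : nat} (P : 'M[R]_(p, n)) (N : 'cV[R]_n -> R).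
Hypotheses (rankP : \rank P = p) (nN : is_norm N).

Lemma full_rank_preimage (u : 'cV[R]_p) : exists x, P *m x = u.
Proof.
have /row_freeP[B PB] : row_free P by rewrite /row_free rankP.
by exists (B *m u); rewrite mulmxA PB mul1mx.
Qed.

Lemma mulmx_continuous : continuous (fun x : 'cV[R]_n => P *m x).
Proof.
apply: (@lipschitz_continuous _ _ _ _ (n%:R * `|P|)) => x y.
rewrite -mulmxBr; apply: ler_mxnorm => [|i j]; first by rewrite !mulr_ge0.
rewrite mxE; apply: le_trans (ler_norm_sum _ _ _) _.
rewrite -mulrA mulr_natl -[n in _ *+ n]card_ord -sumr_const.
apply: ler_sum => l _; rewrite normrM ler_pM //; exact: entry_le_mxnorm.
Qed.

(** The points of the fiber of u where N does not exceed its value at a given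
point form a compact set, since N dominates the sup norm. *)
Lemma image_norm_minimizer u : exists x,
  [/\ P *m x = u, N x = image_norm P N u & forall y, P *m y = u -> N x <= N y].
Proof.
have [x0 Px0] := full_rank_preimage u.
have [c c0 Nc] := is_norm_ge_mxnorm nN.
pose A := [set x | P *m x = u] `&` [set x | N x <= N x0].
have cA : compact A.
  apply: (@bounded_closed_compact_cV _ _ _ (N x0 / c)).
    by move=> x [_ /= xx0]; rewrite ler_pdivlMr // mulrC (le_trans _ xx0).
  apply: closedI.
    apply: (@preimage_closed _ _ (fun x : 'cV[R]_n => P *m x) [set u]).
      by move=> x _; exact: mulmx_continuous.
    apply: compact_closed; [exact: norm_hausdorff | exact: compact_set1].
  apply: (@preimage_closed _ _ N [set r | r <= N x0]); last exact: closed_le.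
  by move=> x _; exact: is_norm_continuous.
have [||x /set_mem[/= Px xx0] xmin] := @compact_EVT_min _ R N A _ cA.
- by exists x0; split=> /=.
- by apply: continuous_subspaceT; exact: is_norm_continuous.
have {}xmin y : P *m y = u -> N x <= N y.
  move=> Py; have [yx0|/ltW x0y] := leP (N y) (N x0); last exact: le_trans x0y.
  by apply: xmin; apply/mem_set; split.
exists x; split=> //; apply/eqP; rewrite eq_le; apply/andP; split.
  by apply: lb_le_inf; [exists (N x0), x0 | move=> _ [y Py <-]; exact: xmin].
by apply: ge_inf; [exists (N x) => _ [y Py <-]; exact: xmin | exists x].
Qed.

Lemma image_norm_le x : image_norm P N (P *m x) <= N x.
Proof.
have [y [_ <- ymin]] := image_norm_minimizer (P *m x); exact: ymin.
Qed.

Lemma image_norm_is_minimum u :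
  is_minimum (fiber_values P N u) (image_norm P N u).
Proof.
have [x [Px <- xmin]] := image_norm_minimizer u.
by split; [exists x | move=> _ [y Py <-]; exact: xmin].
Qed.

Lemma image_norm_is_norm : is_norm (image_norm P N).
Proof.
have [N0 Ndef NZ ND] := nN.
have Zle a u : image_norm P N (a *: u) <= `|a| * image_norm P N u.
  have [x [<- <- _]] := image_norm_minimizer u.
  by rewrite -NZ scalemxAr image_norm_le.
split.
- by move=> u; have [x [_ <- _]] := image_norm_minimizer u.
- by move=> u; have [x [<- <- _ /Ndef ->]] := image_norm_minimizer u; rewrite mulmx0.
- move=> a u; apply/eqP; rewrite eq_le Zle /=.
  have [->|an] := eqVneq a 0.
    rewrite normr0 mul0r; have [x [_ <- _]] := image_norm_minimizer (0 *: u).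
    exact: N0.
  rewrite -ler_pdivlMl ?normr_gt0 // -normfV.
  by apply: le_trans (Zle _ _); rewrite scalerA mulVf // scale1r.
- move=> u v; have [x [<- <- _]] := image_norm_minimizer u.
  have [y [<- <- _]] := image_norm_minimizer v.
  by rewrite -mulmxDr (le_trans (image_norm_le _)).
Qed.

Lemma image_norm_unit_ball X : norm_with_unit_ball N X ->
  norm_with_unit_ball (image_norm P N) (image_body P X).
Proof.
move=> [_ NX]; split; first exact: image_norm_is_norm.
apply/seteqP; split=> [u /=|_ [x Xx <-] /=].
  have [x [<- <- _]] := image_norm_minimizer u => Nx.
  by exists x => //; rewrite -NX.
by apply: le_trans (image_norm_le _) _; move: Xx; rewrite -NX.
Qed.

End ImageNorms.

(** For a 2-homogeneous convex F this is a form of 2-uniform smoothness that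
mentions no derivative. *)
Definition uniformly_smooth {R : realType} n (kappa : R) (F : 'cV[R]_n -> R) :=
  forall x h, F (x + h) + F (x - h) <= 2 * (F x + kappa * F h).

(** If x and y are minimizers over u and v, then x + y and x - y are competitors
over u + v and u - v. *)
Lemma image_norm_smooth {R : realType} p n (P : 'M[R]_(p, n)) N kappa :
  \rank P = p -> is_norm N -> uniformly_smooth kappa (fun x => N x ^+ 2) ->
  uniformly_smooth kappa (fun u => image_norm P N u ^+ 2).
Proof.
move=> rankP nN sN u v.
have [N0 _ _ _] := nN; have [M0 _ _ _] := image_norm_is_norm rankP nN.
have [x [<- <- _]] := image_norm_minimizer rankP nN u.
have [y [<- <- _]] := image_norm_minimizer rankP nN v.
apply: le_trans (sN x y); rewrite -mulmxDr -mulmxBr.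
by rewrite lerD // lerXn2r ?nnegrE // image_norm_le.
Qed.

(** * From uniform smoothness to continuously differentiable squares *)
Section Supergradient.
Context {R : realType} {n : nat} (F : 'cV[R]_n -> R) (kappa : R).
Hypotheses (gF : square_gauge F) (sF : uniformly_smooth kappa F).
Implicit Types (x h k : 'cV[R]_n) (t a : R).

Let slope x h t := (F (x + t *: h) - F x) / t.

Let slopes x h := [set slope x h t | t in [set t | 0 < t]].

(** As the slopes are nondecreasing in t, this infimum is the right derivative of
F at x in the direction h. *)
Let D x h := inf (slopes x h).

Let slope_homo x h s t : 0 < s -> s <= t -> slope x h s <= slope x h t.
Proof.
move=> s0 st; have t0 : 0 < t by exact: lt_le_trans st.
have c0 : 0 <= s / t by rewrite divr_ge0 ?ltW.
have c1 : 0 <= 1 - s / t by rewrite subr_ge0 ler_pdivrMr // mul1r.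
have := square_gauge_convex gF x (x + t *: h) c1 c0 (subrK _ _).
have -> : (1 - s / t) *: x + (s / t) *: (x + t *: h) = x + s *: h.
  by rewrite scalerDr addrA -scalerDl subrK scale1r scalerA divfK // gt_eqF.
move=> Fs; rewrite /slope ler_pdivrMr // mulrAC -mulrA mulrC.
rewrite mulrBr; lra.
Qed.

Let slope_ge x h t : 0 < t -> F x - F (x - h) <= slope x h t.
Proof.
move=> t0; have t10 : 0 < 1 + t by rewrite addr_gt0.
have tn : 1 + t != 0 by rewrite gt_eqF.
have := @square_gauge_convex _ _ _ gF (1 + t)^-1 (t / (1 + t)) (x + t *: h) (x - h).
have -> : (1 + t)^-1 *: (x + t *: h) + (t / (1 + t)) *: (x - h) = x.
  rewrite !scalerDr scalerA addrACA -scalerDl scalerN [t / _]mulrC subrr addr0.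
  by rewrite -{1}[(1 + t)^-1]mulr1 -mulrDr mulVf // scale1r.
have i0 : 0 <= (1 + t)^-1 by rewrite invr_ge0 ltW.
move=> /(_ i0 (mulr_ge0 (ltW t0) i0)).
have -> : (1 + t)^-1 + t / (1 + t) = 1 by field.
move=> /(_ erefl); rewrite [(1 + t)^-1 * _]mulrC [t / _ * _]mulrAC -mulrDl.
by rewrite ler_pdivlMr // => Fx; rewrite /slope ler_pdivlMr //; lra.
Qed.

Let slopes_neq0 x h : slopes x h !=set0.
Proof. by exists (slope x h 1), 1 => //=. Qed.

Let D_le x h t : 0 < t -> D x h <= slope x h t.
Proof.
move=> t0; apply: ge_inf; last by exists t.
by exists (F x - F (x - h)) => _ [s s0 <-]; exact: slope_ge.
Qed.

Let slopeD x h k t : 0 < t ->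
  slope x (h + k) (t / 2) <= slope x h t + slope x k t.
Proof.
move=> t0; have h2 : 0 <= (2^-1 : R) by rewrite invr_ge0.
have := @square_gauge_convex _ _ _ gF 2^-1 2^-1 (x + t *: h) (x + t *: k) h2 h2.
have -> : 2^-1 *: (x + t *: h) + 2^-1 *: (x + t *: k) = x + (t / 2) *: (h + k).
  rewrite !scalerDr addrACA -scalerDl !scalerA ![2^-1 * t]mulrC.
  by rewrite (_ : 2^-1 + 2^-1 = 1) ?scale1r //; field.
have -> : 2^-1 + 2^-1 = 1 :> R by field.
move=> /(_ erefl) Fm; rewrite /slope -mulrDl ler_pdivrMr ?divr_gt0 //.
by rewrite mulrA divfK ?gt_eqF //; lra.
Qed.

Let D_sub x h k : D x (h + k) <= D x h + D x k.
Proof.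
rewrite -lerBlDr -[D x h]mul1r; apply: (@le_mul_inf _ (slopes x h)) => // _ [s s0 <-].
rewrite mul1r lerBlDr -lerBlDl -[D x k]mul1r.
apply: (@le_mul_inf _ (slopes x k)) => // _ [t t0 <-]; rewrite mul1r lerBlDl.
have m0 : 0 < Num.min s t by rewrite lt_min s0 t0.
apply: le_trans (D_le _ _ (divr_gt0 m0 (ltr0n _ 2))) _.
apply: le_trans (slopeD _ _ _ m0) _.
by rewrite lerD // slope_homo // ge_min lexx ?orbT.
Qed.

Let D0 x : D x 0 = 0.
Proof.
rewrite /D (_ : slopes x 0 = [set 0]) ?inf1 //.
apply/seteqP; split=> [_ [t t0 <-]|_ ->].
  by rewrite /slope /= scaler0 addr0 subrr mul0r.
by exists 1 => //=; rewrite /slope scaler0 addr0 subrr mul0r.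
Qed.

(** D (h) + D (- h) is nonnegative by subadditivity, and at most
2 kappa t F h for every t > 0 by uniform smoothness. *)
Let DN x h : D x (- h) = - D x h.
Proof.
apply/eqP; rewrite eq_sym -subr_eq0 -opprD oppr_eq0 eq_le.
apply/andP; split; last by rewrite -(D0 x) -(subrr h) D_sub.
apply/ler_addgt0Pr => e e0; rewrite add0r.
set c := 2 * `|kappa| * F h + 1.
have c0 : 0 < c by rewrite ltr_wpDl // !mulr_ge0 // (square_gauge_ge0 gF).
have t0 : 0 < e / c by rewrite divr_gt0.
apply: le_trans (lerD (D_le x h t0) (D_le x (- h) t0)) _.
rewrite /slope -mulrDl ler_pdivrMr //.
have := sF x ((e / c) *: h); rewrite scalerN (square_gaugeZ gF) => sxh.
have kc : 2 * (kappa * ((e / c) ^+ 2 * F h)) <= (e / c) * (e / c) * c.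
  rewrite [in leRHS]/c -expr2 mulrDr mulr1 ler_wpDr ?sqr_ge0 //.
  have -> : (e / c) ^+ 2 * (2 * `|kappa| * F h) =
      `|kappa| * (2 * ((e / c) ^+ 2 * F h)) by ring.
  rewrite mulrCA ler_wpM2r ?ler_norm //.
  by rewrite mulr_ge0 // mulr_ge0 ?sqr_ge0 ?(square_gauge_ge0 gF).
rewrite -mulrA divfK ?gt_eqF // in kc; lra.
Qed.

Let DD x h k : D x (h + k) = D x h + D x k.
Proof.
apply/eqP; rewrite eq_le D_sub /= -lerBrDr -DN.
by rewrite -{1}[h](addrK k) D_sub.
Qed.

Let DZ x a h : D x (a *: h) = a * D x h.
Proof.
have Zpos b k : 0 < b -> D x (b *: k) <= b * D x k.
  move=> b0; apply: (@le_mul_inf _ (slopes x k)) => //; first exact: ltW.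
  move=> _ [t t0 <-]; apply: le_trans (D_le _ _ (divr_gt0 t0 b0)) _.
  rewrite /slope scalerA divfK ?gt_eqF // invfM invrK.
  by rewrite le_eqVlt; apply/orP; left; apply/eqP; ring.
have {}Zpos b k : 0 < b -> D x (b *: k) = b * D x k.
  move=> b0; apply/eqP; rewrite eq_le Zpos //= -ler_pdivlMl //.
  by apply: le_trans (Zpos _ _ _); rewrite ?invr_gt0 // scalerA mulVf ?gt_eqF // scale1r.
have [a0|a0|->] := ltrgtP a 0; last by rewrite scale0r mul0r D0.
  by rewrite -[a]opprK scaleNr DN Zpos ?oppr_gt0 // !mulNr.
exact: Zpos.
Qed.

(** The remainders of F at x in the directions h and - h are nonnegative by
convexity and add up to at most 2 kappa F h; so each of them is bounded by it. *)
Lemma smooth_supergradient x : exists g : 'cV[R]_n, forall h,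
  0 <= F (x + h) - F x - (g^T *m h) 0 0 <= 2 * kappa * F h.
Proof.
exists (\col_i D x (delta_mx i 0)) => h.
have -> : ((\col_i D x (delta_mx i 0))^T *m h) 0 0 = D x h.
  have Dsum (r : seq 'I_n) (f : 'I_n -> 'cV[R]_n) :
      D x (\sum_(i <- r) f i) = \sum_(i <- r) D x (f i).
    elim: r => [|i r IH]; first by rewrite !big_nil D0.
    by rewrite !big_cons DD IH.
  have {2}-> : h = \sum_i h i 0 *: delta_mx i 0.
    by rewrite {1}[h]matrix_sum_delta; apply: eq_bigr => i _; rewrite big_ord1.
  rewrite Dsum mxE; apply: eq_bigr => i _.
  by rewrite !mxE DZ mulrC.
have D1 k : 0 <= F (x + k) - F x - D x k.
  by have := D_le x k ltr01; rewrite /slope scale1r divr1 => ?; lra.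
rewrite D1 /=; have := D1 (- h); rewrite DN.
have := sF x h => ? ?; lra.
Qed.

End Supergradient.

Section SmoothNorms.
Context {R : realType} {n : nat} (N : 'cV[R]_n -> R) (kappa : R).
Hypotheses (nN : is_norm N) (sN : uniformly_smooth kappa (fun x => N x ^+ 2)).

Let F x := N x ^+ 2.

Let gF : square_gauge F.
Proof. by have [? _ ? ?] := nN; exact: seminorm_square_gauge. Qed.

Let linear_form (g h : 'cV[R]_n) : R := (g^T *m h) 0 0.

Fact linear_form_is_linear g : linear (linear_form g : 'cV[R]_n -> R^o).
Proof. by move=> a h k; rewrite /linear_form mulmxDr -scalemxAr !mxE. Qed.

Lemma sqr_norm_gradient x g :
  (forall h, 0 <= F (x + h) - F x - (g^T *m h) 0 0 <= 2 * kappa * F h) ->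
  differentiable F x /\ gradient F x = g.
Proof.
move=> gx; have [C C0 NC] := is_norm_le_mxnorm nN.
pose df : {linear 'cV[R]_n -> R^o} :=
  HB.pack (linear_form g) (GRing.isLinear.Build _ _ _ _ _ (linear_form_is_linear g)).
have dfc : continuous df.
  apply: (@lipschitz_continuous _ _ _ _ (n%:R * `|g|)) => y z.
  rewrite -raddfB /= /linear_form mxE; apply: le_trans (ler_norm_sum _ _ _) _.
  rewrite -mulrA mulr_natl -[n in _ *+ n]card_ord -sumr_const.
  apply: ler_sum => l _; rewrite [g^T _ _]mxE normrM ler_pM //;
    exact: entry_le_mxnorm.
set B := 2 * `|kappa| * C ^+ 2 + 1.
have B0 : 0 < B by rewrite ltr_wpDl // mulr_ge0 ?sqr_ge0 // mulr_ge0.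
have dfo : F \o shift x = cst (F x) + df +o_ (0 : 'cV[R]_n) id.
  apply/eqaddoP => e e0.
  apply: filterS (@nbhs0_le R 'cV[R]_n _ (divr_gt0 e0 B0)) => h hB.
  have -> : (F \o shift x - (cst (F x) + df)) h = F (x + h) - F x - linear_form g h.
    by rewrite /= !fctE /= /shift /= [h + x]addrC opprD addrA.
  have /andP[lo hi] := gx h.
  rewrite ger0_norm //; apply: le_trans hi _.
  apply: (@le_trans _ _ (B * `|h| * `|h|)).
    have -> : B * `|h| * `|h| = 2 * `|kappa| * (C * `|h|) ^+ 2 + `|h| ^+ 2.
      by rewrite /B; ring.
    rewrite ler_wpDr ?sqr_ge0 // -!mulrA ler_wpM2l //.
    apply: le_trans (ler_wpM2r (sqr_ge0 _) (ler_norm kappa)) _.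
    have [N0 _ _ _] := nN.
    by rewrite ler_wpM2l // /F lerXn2r ?nnegrE // mulr_ge0 // ltW.
  by rewrite ler_wpM2r // mulrC -ler_pdivlMr.
have dE : 'd F x = df :> (_ -> _) by exact: diff_unique dfc dfo.
have dF : differentiable F x.
  by apply/diff_locallyP; rewrite dE.
split=> //; apply/colP => i; rewrite mxE deriveE // dE /= /linear_form mxE.
rewrite (bigD1 i) //= big1 => [|j ji]; first by rewrite !mxE !eqxx mulr1 addr0.
by rewrite !mxE (negPf ji) mulr0.
Qed.

Lemma sqr_norm_gradient_sandwich x h :
  0 <= F (x + h) - F x - ((gradient F x)^T *m h) 0 0 <= 2 * kappa * F h.
Proof.
have [g gx] := smooth_supergradient gF sN x.
by have [_ ->] := sqr_norm_gradient gx.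
Qed.

(** Comparing the expansions of F at x and at y = x + d of the point y + h bounds
the product of gradient F y - gradient F x with h by 2 kappa F (d + h); taking
for h a multiple of a basis vector, of the size of d, shows that the gradient is
Lipschitz. *)
Lemma sqr_norm_gradient_continuous : continuous (gradient F).
Proof.
have [C C0 NC] := is_norm_le_mxnorm nN; have [N0 _ _ _] := nN.
apply: (@lipschitz_continuous _ _ _ _ (8 * `|kappa| * C ^+ 2)) => y x.
have [->|yx] := eqVneq y x; first by rewrite !subrr !normr0 mulr0.
set d := y - x; have d0 : 0 < `|d| by rewrite normr_gt0 subr_eq0.
apply: ler_mxnorm => [|i j]; first by rewrite !(mulr_ge0, sqr_ge0, ltW C0).
have key (h : 'cV[R]_n) : `|h| <= `|d| ->
    ((gradient F y - gradient F x)^T *m h) 0 0 <= 8 * `|kappa| * C ^+ 2 * `|d| ^+ 2.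
  move=> hd.
  have /andP[_ hi] := sqr_norm_gradient_sandwich x (d + h).
  have /andP[lo1 _] := sqr_norm_gradient_sandwich x d.
  have /andP[lo2 _] := sqr_norm_gradient_sandwich y h.
  move: hi lo1 lo2; rewrite addrA [x + d]addrC subrK.
  have trB : (gradient F y - gradient F x)^T = (gradient F y)^T - (gradient F x)^T.
    by rewrite linearB.
  have entryB (a b : 'M[R]_1) : (a - b) 0 0 = a 0 0 - b 0 0 by rewrite !mxE.
  have entryD (a b : 'M[R]_1) : (a + b) 0 0 = a 0 0 + b 0 0 by rewrite !mxE.
  rewrite trB mulmxBl mulmxDr entryD entryB => hi lo1 lo2.
  apply: (@le_trans _ _ (2 * kappa * F (d + h))); first by lra.
  have -> : 8 * `|kappa| * C ^+ 2 * `|d| ^+ 2 =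
      2 * (`|kappa| * (C * (2 * `|d|)) ^+ 2) by ring.
  rewrite -!mulrA ler_wpM2l //.
  apply: le_trans (ler_wpM2r (sqr_ge0 _) (ler_norm kappa)) _.
  rewrite ler_wpM2l // /F lerXn2r ?nnegrE ?mulr_ge0 ?(ltW C0) //.
  apply: le_trans (NC _) _; rewrite ler_wpM2l ?(ltW C0) //.
  by apply: le_trans (ler_normD _ _) _; lra.
rewrite (ord1 j) -(@ler_pM2l _ `|d|) // mulrCA -expr2.
have entry c : ((gradient F y - gradient F x)^T *m
      (c *: (delta_mx i 0 : 'cV[R]_n))) 0 0 =
    c * (gradient F y - gradient F x) i 0.
  rewrite -scalemxAr mxE; congr (_ * _); rewrite mxE (bigD1 i) //= big1 => [|l li].
    by rewrite [_^T _ _]mxE [delta_mx _ _ _ _]mxE !eqxx mulr1 addr0.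
  by rewrite [delta_mx _ _ _ _]mxE (negPf li) mulr0.
have small c : `|c| = `|d| -> `|c *: (delta_mx i 0 : 'cV[R]_n)| <= `|d|.
  move=> cd; apply: ler_mxnorm => // a b; rewrite !mxE normrM cd.
  by rewrite ler_piMr // normr_nat lern1; case: (_ && _).
rewrite -{1}(normr_id d) -normrM ler_norml; apply/andP; split.
  rewrite lerNl -mulNr -entry; apply: key; apply: small.
  by rewrite normrN normr_id.
by rewrite -entry; apply: key; apply: small; rewrite normr_id.
Qed.

Lemma uniformly_smooth_norm : 1 <= 2 * kappa -> smooth_norm (2 * kappa) N.
Proof.
move=> k1; split=> //; first split.
- by move=> x; have [g /sqr_norm_gradient[]] := smooth_supergradient gF sN x.
- exact: sqr_norm_gradient_continuous.
move=> x h; have /andP[_] := sqr_norm_gradient_sandwich x h.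
by rewrite /F => ?; lra.
Qed.

End SmoothNorms.

(** * Bilinear forms and the spectral theorem for symmetric matrices *)
Lemma symmetricmxP {R : realType} n (A : 'M[R]_n) :
  reflect (A^T = A) (A \is symmetricmx).
Proof.
rewrite is_hermitianmxE expr0 scale1r map_mx_id //.
by apply: (iffP eqP) => [<-|->].
Qed.

Lemma discriminant_le {R : realFieldType} (X H z : R) :
  (forall a b, 0 <= a ^+ 2 * X + 2 * (a * b) * z + b ^+ 2 * H) -> z ^+ 2 <= X * H.
Proof.
move=> h.
have X0 : 0 <= X by have := h 1 0; rewrite !(expr1n, mulr0, mul0r, mul1r, expr0n, addr0).
have H0 : 0 <= H by have := h 0 1; rewrite !(expr1n, mulr0, mul0r, mul1r, expr0n, add0r).
have [Hz|Hn] := eqVneq H 0.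
  have [->|zn] := eqVneq z 0; first by rewrite expr0n mulr_ge0.
  have := h 1 (- (X + 1) / (2 * z)).
  have -> : 1 ^+ 2 * X + 2 * (1 * (- (X + 1) / (2 * z))) * z +
      (- (X + 1) / (2 * z)) ^+ 2 * H = - 1.
    by rewrite Hz; field.
  by rewrite lerNr oppr0 ler10.
have Hp : 0 < H by rewrite lt_neqAle eq_sym Hn.
have := h H (- z).
have -> : H ^+ 2 * X + 2 * (H * - z) * z + (- z) ^+ 2 * H = H * (X * H - z ^+ 2) by ring.
by rewrite pmulr_rge0 // subr_ge0.
Qed.

Section BilinearForms.
Context {R : realType} {n : nat}.
Implicit Types (A : 'M[R]_n) (x y z : 'cV[R]_n).

Definition bilin A x y : R := (x^T *m A *m y) 0 0.

Lemma bilinDl A x y z : bilin A (x + y) z = bilin A x z + bilin A y z.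
Proof. by rewrite /bilin linearD /= !mulmxDl mxE. Qed.

Lemma bilinDr A x y z : bilin A z (x + y) = bilin A z x + bilin A z y.
Proof. by rewrite /bilin mulmxDr mxE. Qed.

Lemma bilinZl A a x y : bilin A (a *: x) y = a * bilin A x y.
Proof. by rewrite /bilin linearZ /= -!scalemxAl mxE. Qed.

Lemma bilinZr A a x y : bilin A x (a *: y) = a * bilin A x y.
Proof. by rewrite /bilin -scalemxAr mxE. Qed.

Lemma bilinNl A x y : bilin A (- x) y = - bilin A x y.
Proof. by rewrite -scaleN1r bilinZl mulN1r. Qed.

Lemma bilinNr A x y : bilin A x (- y) = - bilin A x y.
Proof. by rewrite -scaleN1r bilinZr mulN1r. Qed.

Lemma bilin_sym A x y : A^T = A -> bilin A x y = bilin A y x.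
Proof.
move=> AT; rewrite /bilin.
have -> : (x^T *m A *m y) 0 0 = (x^T *m A *m y)^T 0 0 by rewrite [RHS]mxE.
by rewrite !trmx_mul trmxK AT mulmxA.
Qed.

Definition dot x y : R := bilin 1%:M x y.

Lemma dotE x y : dot x y = \sum_i x i 0 * y i 0.
Proof.
by rewrite /dot /bilin mulmx1 mxE; apply: eq_bigr => i _; rewrite mxE.
Qed.

Lemma dot_ge0 x : 0 <= dot x x.
Proof. by rewrite dotE sumr_ge0 // => i _; rewrite -expr2 sqr_ge0. Qed.

Lemma dot_eq0 x : dot x x = 0 -> x = 0.
Proof.
rewrite dotE => /eqP; rewrite psumr_eq0 => [/allP h|i _]; last by rewrite -expr2 sqr_ge0.
apply/colP => i; rewrite mxE; have := h i (mem_index_enum _).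
by rewrite /= mulf_eq0 orbb => /eqP.
Qed.

Lemma dotC x y : dot x y = dot y x.
Proof. by rewrite /dot bilin_sym // trmx1. Qed.

Lemma dotDr x y z : dot z (x + y) = dot z x + dot z y.
Proof. exact: bilinDr. Qed.

Lemma dotZr a x y : dot x (a *: y) = a * dot x y.
Proof. exact: bilinZr. Qed.

Lemma dotZl a x y : dot (a *: x) y = a * dot x y.
Proof. exact: bilinZl. Qed.

Lemma dotNr x y : dot x (- y) = - dot x y.
Proof. exact: bilinNr. Qed.

Lemma bilin_mulr A x y : bilin A x y = dot x (A *m y).
Proof. by rewrite /dot /bilin mulmx1 mulmxA. Qed.

Lemma dot_mulmx (B : 'M[R]_n) x : dot (B *m x) (B *m x) = bilin (B^T *m B) x x.
Proof. by rewrite /dot /bilin mulmx1 trmx_mul !mulmxA. Qed.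

Lemma euclidean_norm_sqr x : euclidean_norm x ^+ 2 = dot x x.
Proof.
rewrite /euclidean_norm sqr_sqrtr ?dotE; first by apply: eq_bigr => i _; rewrite expr2.
by rewrite sumr_ge0 // => i _; rewrite sqr_ge0.
Qed.

Lemma continuous_bigsum (I : Type) (r : seq I) (f : I -> 'cV[R]_n -> R) :
  (forall i, continuous (f i)) -> continuous (fun x => \sum_(i <- r) f i x).
Proof.
move=> fc; elim: r => [|i r IH].
  rewrite (_ : (fun x => _) = fun=> 0); first exact: cst_continuous.
  by apply/funext => x; rewrite big_nil.
rewrite (_ : (fun x => _) = fun x => f i x + \sum_(j <- r) f j x).
  by move=> x; apply: continuousD; [exact: fc | exact: IH].
by apply/funext => x; rewrite big_cons.
Qed.

Lemma bilin_continuous A : continuous (fun x => bilin A x x).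
Proof.
rewrite (_ : (fun x => _) = fun x => \sum_i x i 0 * \sum_j A i j * x j 0).
  apply: continuous_bigsum => i x; apply: continuousM; first exact: coord_continuous.
  apply: continuous_bigsum => j {}x; apply: continuousM; first exact: cst_continuous.
  exact: coord_continuous.
apply/funext => x; rewrite bilin_mulr dotE.
by apply: eq_bigr => i _; rewrite mxE.
Qed.

Lemma dot_continuous y : continuous (fun x => dot y x).
Proof.
rewrite (_ : (fun x => _) = fun x => \sum_i y i 0 * x i 0).
  apply: continuous_bigsum => i x; apply: continuousM; first exact: cst_continuous.
  exact: coord_continuous.
by apply/funext => x; rewrite dotE.
Qed.

(** Positivity is only asked on the plane spanned by x and y: in the spectral
theorem the form is positive just on a subspace. *)
Lemma bilin_Cauchy_Schwarz A x y : A^T = A ->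
  (forall a b, 0 <= bilin A (a *: x + b *: y) (a *: x + b *: y)) ->
  bilin A x y ^+ 2 <= bilin A x x * bilin A y y.
Proof.
move=> AT h; apply: discriminant_le => a b; have := h a b.
rewrite !(bilinDl, bilinDr, bilinZl, bilinZr) (@bilin_sym A y x AT).
by rewrite [X in 0 <= X -> _](_ : _ = a ^+ 2 * bilin A x x +
  2 * (a * b) * bilin A x y + b ^+ 2 * bilin A y y) //; ring.
Qed.

Lemma exists_orthogonal k (u : nat -> 'cV[R]_n) : (k < n)%N ->
  exists2 w, w != 0 & forall i, (i < k)%N -> dot (u i) w = 0.
Proof.
move=> kn; pose M : 'M[R]_(n, k) := \matrix_(i, j) u j i 0.
have /rowV0Pn[v /sub_kermxP vM vn] : kermx M != 0.
  rewrite kermx_eq0 /row_free neq_ltn (leq_ltn_trans (rank_leq_col M)) //.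
exists v^T => [|i ik].
  by apply: contra vn => /eqP v0; rewrite -[v]trmxK v0 trmx0.
have := congr1 (fun B : 'rV[R]_k => B 0 (Ordinal ik)) vM.
rewrite !mxE => <-; rewrite dotE; apply: eq_bigr => j _.
by rewrite !mxE mulrC.
Qed.

(** The next eigenvector is a maximizer y of x^T A x on the unit sphere of the
orthogonal complement W of the previous ones.  With m the maximal value, the form
of m I - A is positive on W and vanishes at y, so by Cauchy-Schwarz
(m I - A) y is orthogonal to W; it also belongs to W, because W is invariant
under A. *)
Lemma orthonormal_eigenvectors A k : A^T = A -> (k <= n)%N ->
  exists (u : nat -> 'cV[R]_n) (d : nat -> R),
    (forall i j, (i < k)%N -> (j < k)%N -> dot (u i) (u j) = (i == j)%:R) /\
    (forall i, (i < k)%N -> A *m u i = d i *: u i).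
Proof.
move=> AT; elim: k => [_|k IH kn].
  by exists (fun=> 0), (fun=> 0); split.
have [u [d [uu ud]]] := IH (ltnW kn).
pose W := [set x | forall i, (i < k)%N -> dot (u i) x = 0].
pose S := W `&` [set x | dot x x = 1].
have WS x : W x -> x != 0 -> S ((Num.sqrt (dot x x))^-1 *: x).
  move=> Wx xn; have x0 : 0 < dot x x.
    by rewrite lt_neqAle dot_ge0 andbT eq_sym; apply/eqP => /dot_eq0 /eqP; apply/negP.
  split=> [i ik|] /=; first by rewrite dotZr Wx // mulr0.
  rewrite dotZl dotZr mulrA -invfM -expr2 sqr_sqrtr ?(ltW x0) // mulVf //.
  by rewrite gt_eqF.
have S0 : S !=set0.
  have [w wn Ww] := exists_orthogonal u kn.
  by eexists; exact: WS wn.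
have cS : compact S.
  apply: (@bounded_closed_compact_cV _ _ _ 1).
    move=> x [_ /= x1]; apply: ler_mxnorm => // i j; rewrite (ord1 j).
    rewrite -(@ler_pXn2r _ 2) ?nnegrE // expr1n -x1 real_normK ?num_real // dotE.
    rewrite (bigD1 i) //= -expr2 lerDl sumr_ge0 // => l _.
    by rewrite -expr2 sqr_ge0.
  have -> : S = \bigcap_(i in [set i | (i < k)%N]) [set x | dot (u i) x = 0] `&`
      [set x | dot x x = 1].
    by apply/seteqP; split=> x [Wx Sx]; split=> // i ik; exact: Wx.
  apply: closedI.
    apply: closed_bigI => i _.
    apply: (@preimage_closed _ _ (fun x => dot (u i) x) [set 0]); last exact: closed_eq.
    by move=> x _; exact: dot_continuous.
  apply: (@preimage_closed _ _ (fun x => dot x x) [set 1]); last exact: closed_eq.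
  by move=> x _; exact: bilin_continuous.
have [||y /set_mem[Wy /= y1] ymax] := @compact_EVT_max _ R (fun x => bilin A x x) S _ cS.
- exact: S0.
- by apply: continuous_subspaceT; exact: bilin_continuous.
set m := bilin A y y in ymax.
pose B := m *: 1%:M - A.
have BT : B^T = B by rewrite /B linearB linearZ /= trmx1 AT.
have bilinB x z : bilin B x z = m * dot x z - bilin A x z.
  rewrite /dot /bilin /B mulmxBr mulmxBl -scalemxAr -scalemxAl.
  by rewrite [LHS]mxE [X in X + _]mxE [X in _ + X]mxE.
have B_ge0 x : W x -> 0 <= bilin B x x.
  move=> Wx; have [->|xn] := eqVneq x 0.
    by rewrite /bilin mulmx0 mxE.
  have := ymax _ (mem_set (WS x Wx xn)).
  have x0 : 0 < dot x x.
    by rewrite lt_neqAle dot_ge0 andbT eq_sym; apply/eqP => /dot_eq0 /eqP; apply/negP.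
  rewrite bilinZl bilinZr mulrA -invfM -expr2 sqr_sqrtr ?(ltW x0) // bilinB subr_ge0.
  by rewrite ler_pdivrMl // mulrC.
have B_orth z : W z -> bilin B y z = 0.
  move=> Wz; apply/eqP; rewrite -sqrf_eq0 eq_le sqr_ge0 andbT.
  have Byy : bilin B y y = 0 by rewrite bilinB y1 mulr1 subrr.
  rewrite -(mul0r (bilin B z z)) -Byy; apply: bilin_Cauchy_Schwarz => // a b.
  apply: B_ge0 => i ik; rewrite dotDr !dotZr.
  by rewrite Wy // Wz // !mulr0 addr0.
have Ay : A *m y = m *: y.
  apply/eqP; rewrite eq_sym -subr_eq0; apply/eqP/dot_eq0.
  have e : m *: y - A *m y = B *m y by rewrite /B mulmxBl -scalemxAl mul1mx.
  rewrite e -bilin_mulr bilin_sym // B_orth // => i ik.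
  rewrite -e dotDr dotZr dotNr Wy // mulr0 -bilin_mulr bilin_sym // bilin_mulr ud //.
  by rewrite dotZr dotC Wy // mulr0 subr0.
exists (fun i => if i == k then y else u i), (fun i => if i == k then m else d i).
have ltS i : (i < k.+1)%N -> i != k -> (i < k)%N.
  by rewrite ltnS leq_eqVlt => /orP[->|].
split=> [i j /ltS ik /ltS jk|i /ltS ik].
  have [ik0|/ik {}ik] := eqVneq i k; have [jk0|/jk {}jk] := eqVneq j k.
  - by rewrite ik0 jk0 eqxx.
  - by rewrite dotC Wy // ik0 eq_sym ltn_eqF.
  - by rewrite Wy // jk0 ltn_eqF.
  - exact: uu.
by case: eqVneq => [_|/ik]; [exact: Ay | exact: ud].
Qed.

Lemma symmetric_spectral A : A^T = A -> exists (U : 'M[R]_n) (d : 'rV[R]_n),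
  [/\ U^T *m U = 1%:M, U *m U^T = 1%:M & A = U *m diag_mx d *m U^T].
Proof.
move=> AT; have [u [d [uu ud]]] := orthonormal_eigenvectors AT (leqnn n).
pose U : 'M[R]_n := \matrix_(i, j) u j i 0.
have UU : U^T *m U = 1%:M.
  apply/matrixP => i j; rewrite !mxE -[RHS](uu i j) // dotE.
  by apply: eq_bigr => l _; rewrite !mxE.
have UU' : U *m U^T = 1%:M by exact: mulmx1C.
exists U, (\row_j d j); split=> //.
rewrite -[LHS]mulmx1 -UU' mulmxA; congr (_ *m _).
rewrite mul_mx_diag; apply/matrixP => i j; rewrite !mxE.
have := congr1 (fun v : 'cV[R]_n => v i 0) (ud j (ltn_ord j)).
rewrite !mxE mulrC => <-; apply: eq_bigr => l _; by rewrite !mxE.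
Qed.

End BilinearForms.

(** * Quadratic forms, square roots and the spectral norm *)
Section QuadraticForms.
Context {R : realType} {n : nat}.
Implicit Types (T : 'M[R]_n) (x y h : 'cV[R]_n).

Lemma possemidef_bilin T : possemidef T -> T^T = T /\ forall x, 0 <= bilin T x x.
Proof. by move=> [/symmetricmxP]. Qed.

(** Convexity: the defect a F x + b F y - F (a x + b y) equals
a b F (x - y) when a + b = 1. *)
Lemma bilin_square_gauge T : possemidef T -> square_gauge (fun x => bilin T x x).
Proof.
move=> /possemidef_bilin[TT T0]; split=> // [a x|a b x y a0 b0 ab].
  by rewrite bilinZl bilinZr expr2 mulrA.
have -> : b = 1 - a by rewrite -ab addrC addKr.
rewrite -subr_ge0.
rewrite [X in 0 <= X](_ : _ = a * b * bilin T (x - y) (x - y)).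
  by rewrite mulr_ge0 ?T0 // mulr_ge0.
have -> : b = 1 - a by rewrite -ab addrC addKr.
rewrite !(bilinDl, bilinDr, bilinZl, bilinZr, bilinNl, bilinNr) (bilin_sym y x TT); ring.
Qed.

Lemma bilin_pow_smooth T q x h : possemidef T ->
  bilin T (x + h) (x + h) ^+ q + bilin T (x - h) (x - h) ^+ q <=
  2 * (bilin T x x + 4 * q%:R * bilin T h h) ^+ q.
Proof.
move=> /possemidef_bilin[TT T0].
have xhT := bilin_Cauchy_Schwarz TT (fun a b => T0 (a *: x + b *: h)).
have := two_point_pow q (T0 x) (T0 h) xhT.
rewrite !(bilinDl, bilinDr, bilinNl, bilinNr) (bilin_sym h x TT).
set X := bilin T x x; set H := bilin T h h; set z := bilin T x h.
have -> : X + z + (z + H) = X + H + 2 * z by ring.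
by have -> : X - z + (- z - - H) = X + H - 2 * z by ring.
Qed.

Lemma dot_square_gauge : square_gauge (fun x : 'cV[R]_n => dot x x).
Proof.
apply: bilin_square_gauge; split; last by move=> x; exact: dot_ge0.
by apply/symmetricmxP; rewrite trmx1.
Qed.

Lemma euclidean_normE x : euclidean_norm x = Num.sqrt (dot x x).
Proof.
by rewrite -euclidean_norm_sqr sqrtr_sqr ger0_norm // sqrtr_ge0.
Qed.

Lemma euclidean_is_norm : is_norm (@euclidean_norm R n).
Proof.
rewrite (_ : @euclidean_norm R n = fun x => Num.sqrt (dot x x)).
  by apply: sqrt_square_gauge_norm dot_square_gauge _ => x; exact: dot_eq0.
by apply/funext => x; rewrite euclidean_normE.
Qed.

End QuadraticForms.

Section OrthogonalDiagonalization.
Context {R : realType} {n : nat} (U : 'M[R]_n).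
Hypotheses (UtU : U^T *m U = 1%:M) (UUt : U *m U^T = 1%:M).
Implicit Types (d e : 'rV[R]_n).

Definition conj_diag d : 'M[R]_n := U *m diag_mx d *m U^T.

Lemma conj_diagM d e :
  conj_diag d *m conj_diag e = conj_diag (\row_j (d 0 j * e 0 j)).
Proof.
by rewrite /conj_diag !mulmxA -[_ *m U^T *m U]mulmxA UtU mulmx1
   -[U *m _ *m diag_mx e]mulmxA mulmx_diag.
Qed.

Lemma conj_diag1 : conj_diag (const_mx 1) = 1%:M.
Proof. by rewrite /conj_diag diag_const_mx mulmx1. Qed.

Lemma conj_diagX d k : conj_diag d ^+ k = conj_diag (\row_j d 0 j ^+ k).
Proof.
elim: k => [|k IH].
  rewrite expr0 (_ : \row__ _ = const_mx 1) ?conj_diag1 //.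
  by apply/rowP => j; rewrite !mxE.
rewrite exprS IH -mulmxE conj_diagM; congr conj_diag.
by apply/rowP => j; rewrite !mxE exprS.
Qed.

Lemma tr_conj_diag d : (conj_diag d)^T = conj_diag d.
Proof. by rewrite /conj_diag !trmx_mul trmxK tr_diag_mx mulmxA. Qed.

Lemma mxtrace_conj_diag d : \tr (conj_diag d) = \sum_i d 0 i.
Proof. by rewrite /conj_diag mxtrace_mulC mulmxA UtU mul1mx mxtrace_diag. Qed.

Lemma bilin_conj_diag d x :
  bilin (conj_diag d) x x = \sum_i d 0 i * ((U^T *m x) i 0) ^+ 2.
Proof.
have -> : bilin (conj_diag d) x x = bilin (diag_mx d) (U^T *m x) (U^T *m x).
  by rewrite /bilin /conj_diag trmx_mul trmxK !mulmxA.
rewrite bilin_mulr dotE; apply: eq_bigr => i _.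
by rewrite mul_diag_mx !mxE; ring.
Qed.

Lemma dot_orthogonal x : dot (U^T *m x) (U^T *m x) = dot x x.
Proof. by rewrite dot_mulmx trmxK UUt. Qed.

Lemma bilin_conj_diag_col d i : bilin (conj_diag d) (col i U) (col i U) = d 0 i.
Proof.
have Ui : U^T *m col i U = delta_mx i 0.
  by rewrite colE mulmxA UtU mul1mx.
rewrite bilin_conj_diag Ui (bigD1 i) //= big1 => [|j ji].
  by rewrite !mxE !eqxx expr1n mulr1 addr0.
by rewrite mxE (negPf ji) expr0n mulr0.
Qed.

(** In the coordinates given by U an eigenvector is a nonzero row v U with
(v U) diag d = l (v U), and any of its nonzero entries identifies l. *)
Lemma eigenvalue_conj_diag d l :
  eigenvalue (conj_diag d) l <-> exists i, d 0 i = l.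
Proof.
split=> [/eigenvalueP[v vl vn]|[i <-]].
  have wl : (v *m U) *m diag_mx d = l *: (v *m U).
    have := congr1 (mulmx^~ U) vl.
    by rewrite /conj_diag -!mulmxA UtU mulmx1 -scalemxAl.
  have /rV0Pn[i wi] : v *m U != 0.
    by apply: contra vn => /eqP vU; rewrite -[v]mulmx1 -UUt mulmxA vU mul0mx.
  exists i; move/rowP: wl => /(_ i); rewrite mul_mx_diag mxE [RHS]mxE mulrC => h.
  exact: (mulIf wi).
apply/eigenvalueP; exists (row i U^T).
  rewrite /conj_diag !mulmxA -row_mul UtU row1 -rowE.
  apply/rowP => j; rewrite !mxE (bigD1 i) //= big1 => [|m mi].
    by rewrite !mxE eqxx addr0.
  by rewrite !mxE eq_sym (negPf mi) mul0r.
apply/eqP => /(congr1 (mulmx^~ U)) /eqP; rewrite mul0mx -row_mul UtU row1.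
move=> /eqP /rowP /(_ i); rewrite !mxE !eqxx => /eqP.
by rewrite oner_eq0.
Qed.

End OrthogonalDiagonalization.

Section SquareRootMatrix.
Context {R : realType} {n : nat}.

Lemma sqrtmxP (T : 'M[R]_n) : possemidef T ->
  possemidef (sqrtmx T) /\ sqrtmx T *m sqrtmx T = T.
Proof.
move=> /possemidef_bilin[TT T0].
apply: (@xgetPex _ 0 [set B : 'M[R]_n | possemidef B /\ B *m B = T]).
have [U [d [UtU UUt dT]]] := symmetric_spectral TT.
rewrite -/(conj_diag U d) in dT.
exists (conj_diag U (\row_j Num.sqrt (d 0 j))); split; last first.
  rewrite conj_diagM // dT; congr conj_diag; apply/rowP => j; rewrite !mxE.
  by rewrite -expr2 sqr_sqrtr // -(bilin_conj_diag_col UtU) -dT.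
split=> [|x]; first by apply/symmetricmxP; exact: tr_conj_diag.
rewrite -[leRHS]/(bilin _ x x) bilin_conj_diag sumr_ge0 // => i _.
by rewrite mulr_ge0 ?sqr_ge0 // mxE sqrtr_ge0.
Qed.

Lemma euclidean_norm_sqrtmx (T : 'M[R]_n) x : possemidef T ->
  euclidean_norm (sqrtmx T *m x) ^+ 2 = bilin T x x.
Proof.
move=> /sqrtmxP[/possemidef_bilin[BT _] BB].
by rewrite euclidean_norm_sqr dot_mulmx BT BB.
Qed.

End SquareRootMatrix.

Section SpectralNorm.
Context {R : realType} {n : nat}.
Implicit Types (S : 'M[R]_n) (c : R).

Lemma spectral_normE (U : 'M[R]_n) (d : 'rV[R]_n) :
  U^T *m U = 1%:M -> U *m U^T = 1%:M ->
  spectral_norm (conj_diag U d) = sup [set `|d 0 i| | i in [set: 'I_n]].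
Proof.
move=> UtU UUt; rewrite /spectral_norm tr_conj_diag conj_diagM //; congr sup.
apply/seteqP; split=> [_ [l /= /(eigenvalue_conj_diag UtU UUt)[i <-] <-]|_ [i _ <-]].
  by exists i => //; rewrite mxE -expr2 sqrtr_sqr.
exists (d 0 i ^+ 2); last by rewrite sqrtr_sqr.
by apply/(eigenvalue_conj_diag UtU UUt); exists i; rewrite mxE expr2.
Qed.

(** The moduli of the eigenvalues d of S control the spectral norm, the operator
bound for the Euclidean norm, and the traces of powers of S. *)
Lemma spectral_norm_diagonalization S : S^T = S -> exists d : 'rV[R]_n,
  [/\ forall i, `|d 0 i| <= spectral_norm S,
      forall c, 0 <= c -> (forall i, `|d 0 i| <= c) -> spectral_norm S <= c,
      forall k, \tr (S ^+ k) = \sum_i d 0 i ^+ k &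
      forall c, 0 <= c -> (forall i, `|d 0 i| <= c) <->
        (forall x, euclidean_norm (S *m x) <= c * euclidean_norm x)].
Proof.
move=> ST; have [U [d [UtU UUt dS]]] := symmetric_spectral ST.
rewrite -/(conj_diag U d) in dS.
have SE : spectral_norm S = sup [set `|d 0 i| | i in [set: 'I_n]].
  by rewrite dS spectral_normE.
exists d; split.
- move=> i; rewrite SE; apply: ub_le_sup; last by exists i.
  exists (\sum_j `|d 0 j|) => _ [j _ <-].
  by rewrite (bigD1 j) //= lerDl sumr_ge0.
- move=> c c0 dc; rewrite SE.
  have [[r Er]|E0] := pselect ([set `|d 0 i| | i in [set: 'I_n]] !=set0).
    by apply: ge_sup; [exists r | move=> _ [i _ <-]].
  have -> : [set `|d 0 i| | i in [set: 'I_n]] = set0.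
    by apply/seteqP; split=> // r Er; case: E0; exists r.
  by rewrite sup0.
- move=> k; rewrite {1}dS conj_diagX // mxtrace_conj_diag //.
  by apply: eq_bigr => i _; rewrite mxE.
have Sx x : dot (S *m x) (S *m x) = \sum_i d 0 i ^+ 2 * ((U^T *m x) i 0) ^+ 2.
  rewrite dot_mulmx ST {1 2}dS conj_diagM // bilin_conj_diag.
  by apply: eq_bigr => i _; rewrite mxE expr2.
move=> c c0; split=> [dc x|cS i].
  rewrite -(@ler_pXn2r _ 2) ?nnegrE ?mulr_ge0 ?sqrtr_ge0 // exprMn !euclidean_norm_sqr.
  rewrite Sx -(dot_orthogonal UUt) dotE mulr_sumr; apply: ler_sum => i _.
  rewrite -expr2 ler_wpM2r ?sqr_ge0 // -(real_normK (num_real (d 0 i))).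
  by rewrite lerXn2r ?nnegrE.
have := cS (col i U).
rewrite -(@ler_pXn2r _ 2) ?nnegrE ?mulr_ge0 ?sqrtr_ge0 // exprMn !euclidean_norm_sqr.
rewrite dot_mulmx ST {1 2}dS conj_diagM // bilin_conj_diag_col //.
have -> : dot (col i U) (col i U) = 1.
  by rewrite /dot -(conj_diag1 UUt) bilin_conj_diag_col // mxE.
rewrite mxE mulr1 -expr2 -(real_normK (num_real (d 0 i))).
by rewrite ler_pXn2r ?nnegrE.
Qed.

Lemma spectral_normP S c : S^T = S -> 0 <= c ->
  (forall x, euclidean_norm (S *m x) <= c * euclidean_norm x) <->
  spectral_norm S <= c.
Proof.
move=> ST c0; have [d [dS Sd _ dE]] := spectral_norm_diagonalization ST.
split=> [/dE h|Sc]; first by apply: Sd => //; exact/h.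
by apply/dE => // i; exact: le_trans Sc.
Qed.

Lemma spectral_norm_ge0 S : 0 <= spectral_norm S.
Proof.
rewrite /spectral_norm; set E := [set _ | _ in _].
have [ubE|nubE] := pselect (has_ubound E); last by rewrite sup_out // => -[].
have [[r Er]|E0] := pselect (E !=set0).
  apply: le_trans (ub_le_sup ubE Er).
  by case: Er => l _ <-; exact: sqrtr_ge0.
by rewrite sup_out // => -[].
Qed.

Lemma spectral_norm_bound S x : S^T = S ->
  euclidean_norm (S *m x) <= spectral_norm S * euclidean_norm x.
Proof. by move=> ST; move: x; apply/spectral_normP => //; exact: spectral_norm_ge0. Qed.

Lemma spectral_normD S1 S2 : S1^T = S1 -> S2^T = S2 ->
  spectral_norm (S1 + S2) <= spectral_norm S1 + spectral_norm S2.
Proof.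
move=> S1T S2T; apply/spectral_normP.
- by rewrite linearD /= S1T S2T.
- by rewrite addr_ge0 ?spectral_norm_ge0.
have [_ _ _ eD] := @euclidean_is_norm R n.
move=> x; rewrite mulmxDl mulrDl; apply: le_trans (eD _ _) _.
by rewrite lerD ?spectral_norm_bound.
Qed.

Lemma spectral_normZ a S : S^T = S ->
  spectral_norm (a *: S) = `|a| * spectral_norm S.
Proof.
have [e0 _ eZ _] := @euclidean_is_norm R n.
have Zle b S' : S'^T = S' -> spectral_norm (b *: S') <= `|b| * spectral_norm S'.
  move=> ST; apply/spectral_normP => [||x].
  - by rewrite linearZ /= ST.
  - by rewrite mulr_ge0 ?spectral_norm_ge0.
  by rewrite -scalemxAl eZ -mulrA ler_wpM2l // spectral_norm_bound.
move=> ST; apply/eqP; rewrite eq_le Zle //=.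
have [->|an] := eqVneq a 0; first by rewrite normr0 mul0r spectral_norm_ge0.
rewrite -ler_pdivlMl ?normr_gt0 // -normfV.
rewrite -{1}[S]scale1r -(mulVf an) -scalerA; apply: Zle.
by rewrite linearZ /= ST.
Qed.

Lemma spectral_norm_eq0 S : S^T = S -> spectral_norm S = 0 -> S = 0.
Proof.
have [e0 edef _ _] := @euclidean_is_norm R n.
move=> ST S0; apply/matrixP => i j; rewrite [RHS]mxE.
have /edef Sj : euclidean_norm (S *m delta_mx j 0) = 0.
  apply/eqP; rewrite eq_le e0 andbT.
  by apply: le_trans (spectral_norm_bound _ ST) _; rewrite S0 mul0r.
by have := congr1 (fun v : 'cV[R]_n => v i 0) Sj; rewrite -colE !mxE.
Qed.

Lemma loewner_le_scalar S t : S^T = S -> 0 <= t ->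
  loewner_le (S *m S) t%:M <-> spectral_norm S ^+ 2 <= t.
Proof.
move=> ST t0.
have diffE x : bilin (t%:M - S *m S) x x = t * dot x x - dot (S *m x) (S *m x).
  rewrite dot_mulmx ST /dot /bilin mulmxBr mulmxBl -[t%:M]scalemx1.
  by rewrite -scalemxAr -scalemxAl [LHS]mxE [X in X + _]mxE [X in _ + X]mxE.
have sqrtP : spectral_norm S ^+ 2 <= t <-> spectral_norm S <= Num.sqrt t.
  rewrite -{1}(sqr_sqrtr t0) ler_pXn2r ?nnegrE ?sqrtr_ge0 ?spectral_norm_ge0 //.
apply: (iff_trans _ (iff_sym sqrtP)).
apply: (iff_trans _ (spectral_normP ST (sqrtr_ge0 t))).
have pointP x : 0 <= bilin (t%:M - S *m S) x x <->
    euclidean_norm (S *m x) <= Num.sqrt t * euclidean_norm x.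
  rewrite diffE subr_ge0 -[in X in _ <-> X](@ler_pXn2r _ 2) ?nnegrE
    ?mulr_ge0 ?sqrtr_ge0 //.
  by rewrite exprMn !euclidean_norm_sqr (sqr_sqrtr t0).
split=> [[_ _ [_ h]] x|h]; first by apply/pointP; exact: h.
have SST : (S *m S)^T = S *m S by rewrite trmx_mul ST.
split; try apply/symmetricmxP.
- exact: SST.
- by rewrite tr_scalar_mx.
split; first by apply/symmetricmxP; rewrite linearB /= tr_scalar_mx SST.
by move=> x; apply/pointP; exact: h.
Qed.

End SpectralNorm.

(** * Traces of words in two symmetric matrices *)
Section Words.

Fixpoint words m : seq (seq bool) :=
  if m is m'.+1 then map (cons true) (words m') ++ map (cons false) (words m')
  else [:: [::]].

Lemma size_words m w : w \in words m -> size w = m.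
Proof.
elim: m w => [|m IH] w /=; first by rewrite inE => /eqP ->.
by rewrite mem_cat => /orP[] /mapP[v /IH <- ->].
Qed.

(** A word in two letters is a list of booleans, true standing for x and false
for y. *)
Definition word_prod (A : pzRingType) (x y : A) (w : seq bool) : A :=
  \prod_(b <- w) (if b then x else y).

Lemma word_prod_cons (A : pzRingType) (x y : A) b w :
  word_prod x y (b :: w) = (if b then x else y) * word_prod x y w.
Proof. exact: big_cons. Qed.

Lemma word_prod_cat (A : pzRingType) (x y : A) v w :
  word_prod x y (v ++ w) = word_prod x y v * word_prod x y w.
Proof. exact: big_cat. Qed.

Lemma word_prod_nseq (A : pzRingType) (x y : A) m b :
  word_prod x y (nseq m b) = (if b then x else y) ^+ m.
Proof.
elim: m => [|m IH]; first by rewrite /word_prod big_nil expr0.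
by rewrite /= word_prod_cons IH exprS.
Qed.

Lemma exprD_words (A : pzRingType) (x y : A) m :
  (x + y) ^+ m = \sum_(w <- words m) word_prod x y w.
Proof.
elim: m => [|m IH] /=; first by rewrite expr0 big_seq1 /word_prod big_nil.
rewrite exprS IH mulrDl big_cat !big_map !mulr_sumr.
by congr (_ + _); apply: eq_bigr => w _; rewrite word_prod_cons.
Qed.

End Words.

Section WordTraces.
Context {R : realType} {n : nat}.
Implicit Types (X H : 'M[R]_n) (w : seq bool).

Lemma mxtrace_Cauchy_Schwarz (A B : 'M[R]_n) :
  (\tr (A *m B)) ^+ 2 <= \tr (A *m A^T) * \tr (B^T *m B).
Proof.
have trge0 (C : 'M[R]_n) : 0 <= \tr (C *m C^T).
  rewrite /mxtrace sumr_ge0 // => i _; rewrite mxE sumr_ge0 // => j _.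
  by rewrite mxE -expr2 sqr_ge0.
apply: discriminant_le => a b; have := trge0 (a *: A + b *: B^T).
rewrite linearD !linearZ /= trmxK mulmxDl !mulmxDr.
rewrite -!scalemxAl -!scalemxAr !mxtraceD !mxtraceZ.
have -> : \tr (B^T *m A^T) = \tr (A *m B) by rewrite -trmx_mul mxtrace_tr.
rewrite [X in 0 <= X -> _](_ : _ = a ^+ 2 * \tr (A *m A^T) +
  2 * (a * b) * \tr (A *m B) + b ^+ 2 * \tr (B^T *m B)) //.
by ring.
Qed.

Lemma word_prodZ (x h : R) X H w :
  word_prod (x *: X) (h *: H) w = word_prod x h w *: word_prod X H w.
Proof.
elim: w => [|b w IH]; first by rewrite /word_prod !big_nil scale1r.
rewrite !word_prod_cons IH -!mulmxE; case: b.
  by rewrite -scalemxAl -scalemxAr scalerA.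
by rewrite -scalemxAl -scalemxAr scalerA.
Qed.

Lemma trmx_word_prod X H w : X^T = X -> H^T = H ->
  (word_prod X H w)^T = word_prod X H (rev w).
Proof.
move=> XT HT; elim: w => [|b w IH]; first by rewrite /word_prod !big_nil trmx1.
rewrite word_prod_cons -mulmxE trmx_mul IH rev_cons -cats1 word_prod_cat -mulmxE.
by congr (_ *m _); rewrite /word_prod big_seq1; case: b; rewrite ?XT ?HT.
Qed.

Lemma mxtrace_word_rot X H v w :
  \tr (word_prod X H (v ++ w)) = \tr (word_prod X H (w ++ v)).
Proof. by rewrite !word_prod_cat -!mulmxE mxtrace_mulC. Qed.

(** Cauchy-Schwarz for the pairing (A, B) |-> tr (A B): each half of a word is
replaced by a palindrome built on the other half. *)
Lemma word_trace_reflect X H v w : X^T = X -> H^T = H ->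
  (\tr (word_prod X H (v ++ w))) ^+ 2 <=
  \tr (word_prod X H (v ++ rev v)) * \tr (word_prod X H (rev w ++ w)).
Proof.
move=> XT HT; rewrite !word_prod_cat -!mulmxE.
by rewrite -!trmx_word_prod // mxtrace_Cauchy_Schwarz.
Qed.

(** A chessboard estimate.  Among the words of length 2 q take one whose trace is
maximal in modulus.  By word_trace_reflect, its reflection v ++ rev v is again
maximal.  If a cyclic rotation puts a run of l <= q equal letters at the end of
the first half, the reflection has a run of length 2 l; repeating this produces a
maximal word which is constant, and its trace is 1. *)
Lemma word_trace_le1 X H q w : X^T = X -> H^T = H -> (0 < q)%N ->
  \tr (X ^+ (q + q)) = 1 -> \tr (H ^+ (q + q)) = 1 -> size w = (q + q)%N ->
  `|\tr (word_prod X H w)| <= 1.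
Proof.
move=> XT HT q0 X1 H1 sw.
pose F v := `|\tr (word_prod X H v)|.
have [w0 sw0 Fmax] : exists2 w0, size w0 = (q + q)%N &
    forall v, size v = (q + q)%N -> F v <= F w0.
  case: (@Order.TotalTheory.arg_maxP _ _ _ (nseq_tuple (q + q) true) xpredT
    (fun t : (q + q).-tuple bool => F t) isT) => t _ tmax.
  exists t; first by rewrite size_tuple.
  by move=> v /eqP sv; exact: (tmax (Tuple sv)).
have [F0|F0] := eqVneq (F w0) 0; first by rewrite (le_trans (Fmax _ sw)) // F0.
have Fp : 0 < F w0 by rewrite lt_neqAle eq_sym F0 normr_ge0.
have reflect v u : size v = q -> size u = q -> F (v ++ u) = F w0 ->
    F (v ++ rev v) = F w0.
  move=> sv su Fvu.
  apply/eqP; rewrite eq_le Fmax /= ?size_cat ?size_rev ?sv //.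
  rewrite -(@ler_pM2r _ (F w0)) // -expr2 -{1}Fvu /F real_normK ?num_real //.
  apply: le_trans (word_trace_reflect v u XT HT) _.
  apply: le_trans (ler_norm _) _; rewrite normrM ler_wpM2l //.
  by apply: Fmax; rewrite size_cat size_rev su.
have run l : (0 < l <= q)%N -> exists b r, size (nseq l b ++ r) = (q + q)%N /\
    F (nseq l b ++ r) = F w0.
  elim: l => // l IH /andP[_ lq].
  (* A run of length 2 l contains one of length l + 1, which suffices. *)
  have [->|l0] := eqVneq l 0%N.
    case: w0 sw0 {Fmax F0 Fp reflect IH} => [|b r] /= sw0; first by lia.
    by exists b, r.
  have [|b [r [sr Fr]]] := IH; first by lia.
  pose v := take q r; pose u := drop q r.
  have rvu : r = v ++ u by rewrite cat_take_drop.
  move: sr; rewrite size_cat size_nseq => sr.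
  have sv : size v = q by rewrite size_takel; lia.
  have su : size u = (q - l)%N by rewrite size_drop; lia.
  have Fuv : F ((u ++ nseq l b) ++ v) = F w0.
    by rewrite -Fr rvu /F -catA mxtrace_word_rot catA.
  have := reflect _ _ _ sv Fuv; rewrite size_cat size_nseq => /(_ _).
  rewrite rev_cat rev_nseq => Frun.
  exists b, (nseq l.-1 b ++ rev u ++ u).
  have lE : nseq l.+1 b ++ nseq l.-1 b = nseq l b ++ nseq l b.
    by rewrite -!nseqD; congr nseq; lia.
  rewrite catA lE; split.
    by rewrite !size_cat !size_nseq size_rev su; lia.
  rewrite -Frun; last by lia.
  by rewrite /F -!catA [in RHS]mxtrace_word_rot -!catA.
have [b [r [sr Fr]]] : exists b r, size (nseq q b ++ r) = (q + q)%N /\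
    F (nseq q b ++ r) = F w0 by apply: run; lia.
move: sr; rewrite size_cat size_nseq => sr.
have sr' : size r = q by lia.
apply: (le_trans (Fmax _ sw)).
rewrite -(reflect _ _ (size_nseq q b) sr' Fr) rev_nseq -nseqD /F word_prod_nseq.
by case: b {Fr}; rewrite ?X1 ?H1 normr1.
Qed.

End WordTraces.

(** * Schatten norms of even order *)

(** The Schatten norm of order 2 q. *)
HB.lock Definition schatten {R : realType} {n} (q : nat) (X : 'M[R]_n) : R :=
  (\tr (X ^+ (q + q))) `^ ((q + q)%:R)^-1.

Section Schatten.
Context {R : realType} {n : nat} (q : nat).
Hypothesis q_gt0 : (0 < q)%N.
Implicit Types (X H : 'M[R]_n).

Lemma schatten_ge0 X : 0 <= schatten q X.
Proof. by rewrite schatten.unlock powR_ge0. Qed.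

Lemma schattenX X : X^T = X -> schatten q X ^+ (q + q) = \tr (X ^+ (q + q)).
Proof.
move=> XT; have [d [_ _ trd _]] := spectral_norm_diagonalization XT.
rewrite schatten.unlock -powR_mulrn ?powR_ge0 // -powRrM mulVf ?pnatr_eq0; last by lia.
by rewrite powRr1 // trd sumr_ge0 // => i _; rewrite exprD -expr2 sqr_ge0.
Qed.

Lemma spectral_norm_le_schatten X : X^T = X -> spectral_norm X <= schatten q X.
Proof.
move=> XT; have [d [_ dX trd _]] := spectral_norm_diagonalization XT.
have even_norm i : `|d 0 i| ^+ (q + q) = d 0 i ^+ (q + q).
  by rewrite -normrX ger0_norm // exprD -expr2 sqr_ge0.
apply: dX => [|i]; first exact: schatten_ge0.
rewrite -(@ler_pXn2r _ (q + q)) ?nnegrE ?schatten_ge0 //; last by lia.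
rewrite schattenX // trd even_norm (bigD1 i) //= lerDl sumr_ge0 // => j _.
by rewrite exprD -expr2 sqr_ge0.
Qed.

Lemma schatten_le_spectral_norm X : X^T = X -> (n <= 2 ^ q)%N ->
  schatten q X ^+ 2 <= 2 * spectral_norm X ^+ 2.
Proof.
move=> XT nq; have [d [dX _ trd _]] := spectral_norm_diagonalization XT.
have even_norm i : `|d 0 i| ^+ (q + q) = d 0 i ^+ (q + q).
  by rewrite -normrX ger0_norm // exprD -expr2 sqr_ge0.
have s0 := sqr_ge0 (schatten q X).
have t0 : 0 <= 2 * spectral_norm X ^+ 2 by rewrite mulr_ge0 // sqr_ge0.
rewrite -(@ler_pXn2r _ q) ?nnegrE //.
rewrite -exprM mul2n -addnn schattenX // trd exprMn -exprM mul2n -addnn.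
apply: (@le_trans _ _ (\sum_(i < n) spectral_norm X ^+ (q + q))).
  apply: ler_sum => i _; rewrite -even_norm lerXn2r ?nnegrE //.
  exact: spectral_norm_ge0.
rewrite sumr_const card_ord -[leLHS]mulr_natl ler_wpM2r ?exprn_ge0 ?spectral_norm_ge0 //.
by rewrite -natrX ler_nat.
Qed.

Lemma schatten_eq0 X : X^T = X -> schatten q X = 0 -> X = 0.
Proof.
move=> XT X0; apply: spectral_norm_eq0 => //; apply/eqP.
by rewrite eq_le spectral_norm_ge0 -X0 spectral_norm_le_schatten.
Qed.

Lemma schattenZ a X : X^T = X -> schatten q (a *: X) = `|a| * schatten q X.
Proof.
move=> XT; have aXT : (a *: X)^T = a *: X by rewrite linearZ /= XT.
apply: (@pexpIrn _ (q + q)); rewrite ?nnegrE ?mulr_ge0 ?schatten_ge0 //; first by lia.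
rewrite exprMn (schattenX aXT) (schattenX XT).
have -> : (a *: X) ^+ (q + q) = a ^+ (q + q) *: X ^+ (q + q).
  elim: (q + q)%N => [|m IH]; first by rewrite !expr0 scale1r.
  by rewrite !exprS IH -!mulmxE -scalemxAl -scalemxAr scalerA.
by rewrite mxtraceZ -normrX ger0_norm // exprD -expr2 sqr_ge0.
Qed.

(** The noncommutative Hoelder inequality for words, by normalizing X and H. *)
Lemma word_trace_le X H w : X^T = X -> H^T = H ->
  0 < schatten q X -> 0 < schatten q H -> size w = (q + q)%N ->
  \tr (word_prod X H w) <= word_prod (schatten q X) (schatten q H) w.
Proof.
move=> XT HT x0 h0 sw.
have unit (Y : 'M[R]_n) : Y^T = Y -> 0 < schatten q Y ->
    ((schatten q Y)^-1 *: Y)^T = (schatten q Y)^-1 *: Y /\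
    \tr (((schatten q Y)^-1 *: Y) ^+ (q + q)) = 1.
  move=> YT y0; have yYT : ((schatten q Y)^-1 *: Y)^T = (schatten q Y)^-1 *: Y.
    by rewrite linearZ /= YT.
  split=> //; rewrite -schattenX // schattenZ // normfV ger0_norm ?ltW //.
  by rewrite mulVf ?expr1n // gt_eqF.
have [uXT uX] := unit X XT x0; have [uHT uH] := unit H HT h0.
have := word_trace_le1 uXT uHT q_gt0 uX uH sw.
move=> /(le_trans (ler_norm _)) le1.
have w0 : 0 <= word_prod (schatten q X) (schatten q H) w.
  by apply: prodr_ge0 => b _; case: b; rewrite schatten_ge0.
have -> : word_prod X H w = word_prod (schatten q X) (schatten q H) w *:
    word_prod ((schatten q X)^-1 *: X) ((schatten q H)^-1 *: H) w.
  have xn : schatten q X != 0 by rewrite gt_eqF.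
  have hn : schatten q H != 0 by rewrite gt_eqF.
  by rewrite -word_prodZ !scalerA (divff xn) (divff hn) !scale1r.
by rewrite mxtraceZ ler_piMr.
Qed.

Lemma mxtrace_sum_words (f : seq bool -> 'M[R]_n) (s : seq (seq bool)) :
  \tr (\sum_(w <- s) f w) = \sum_(w <- s) \tr (f w).
Proof. exact: raddf_sum. Qed.

Lemma schattenD X H : X^T = X -> H^T = H ->
  schatten q (X + H) <= schatten q X + schatten q H.
Proof.
move=> XT HT; have XHT : (X + H)^T = X + H by rewrite linearD /= XT HT.
have [/(schatten_eq0 XT) ->|xn] := eqVneq (schatten q X) 0.
  by rewrite add0r lerDr schatten_ge0.
have [/(schatten_eq0 HT) ->|hn] := eqVneq (schatten q H) 0.
  by rewrite addr0 lerDl schatten_ge0.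
have x0 : 0 < schatten q X by rewrite lt_neqAle eq_sym xn schatten_ge0.
have h0 : 0 < schatten q H by rewrite lt_neqAle eq_sym hn schatten_ge0.
rewrite -(@ler_pXn2r _ (q + q)) ?nnegrE ?addr_ge0 ?schatten_ge0 //; last by lia.
rewrite (schattenX XHT) !exprD_words mxtrace_sum_words.
rewrite big_seq [leRHS]big_seq; apply: ler_sum => w /size_words sw.
exact: word_trace_le.
Qed.

(** In the sum of the two expansions a word with j letters H has the
coefficient 1 + (-1)^j >= 0, both for matrices and for the scalars that bound
their traces. *)
Lemma schatten_two_point X H : X^T = X -> H^T = H ->
  schatten q (X + H) ^+ (q + q) + schatten q (X - H) ^+ (q + q) <=
  (schatten q X + schatten q H) ^+ (q + q) + (schatten q X - schatten q H) ^+ (q + q).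
Proof.
move=> XT HT; have XHT : (X + H)^T = X + H by rewrite linearD /= XT HT.
have XHT' : (X - H)^T = X - H by rewrite linearB /= XT HT.
have even_opp (A : pzRingType) (y : A) : (- y) ^+ (q + q) = y ^+ (q + q).
  by rewrite addnn -mul2n exprM sqrrN -exprM.
have sch0 : schatten q (0 : 'M[R]_n) = 0.
  by have := schattenZ 0 XT; rewrite scale0r normr0 mul0r.
have [X0|xn] := eqVneq (schatten q X) 0.
  rewrite X0 (schatten_eq0 XT X0) !add0r even_opp.
  by rewrite -[- H]scaleN1r schattenZ // normrN1 mul1r.
have [H0|hn] := eqVneq (schatten q H) 0.
  by rewrite H0 (schatten_eq0 HT H0) !addr0 !subr0.
have x0 : 0 < schatten q X by rewrite lt_neqAle eq_sym xn schatten_ge0.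
have h0 : 0 < schatten q H by rewrite lt_neqAle eq_sym hn schatten_ge0.
rewrite (schattenX XHT) (schattenX XHT') !exprD_words !mxtrace_sum_words.
rewrite -!big_split /=.
rewrite big_seq [leRHS]big_seq; apply: ler_sum => w /size_words sw.
pose s : R := word_prod 1 (- 1) w.
have s1 : 0 <= 1 + s.
  have : `|s| = 1.
    rewrite /s; elim: w {sw s} => [|b w IH]; first by rewrite /word_prod big_nil normr1.
    by rewrite word_prod_cons normrM IH mulr1; case: b; rewrite ?normrN normr1.
  move=> s1; have := ler_norm (- s).
  by rewrite normrN s1 lerNl addrC -lerBlDr sub0r.
have -> : word_prod X (- H) w = s *: word_prod X H w.
  by rewrite -word_prodZ scale1r scaleN1r.
have -> : word_prod (schatten q X) (- schatten q H) w =
    s * word_prod (schatten q X) (schatten q H) w.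
  rewrite /s; elim: w {sw s s1} => [|b w IH]; first by rewrite /word_prod !big_nil mulr1.
  by rewrite !word_prod_cons IH; case: b; ring.
rewrite mxtraceZ -{1}[\tr _]mul1r -{1}[word_prod (schatten q _) _ _]mul1r -!mulrDl.
by rewrite ler_wpM2l // word_trace_le.
Qed.

Lemma schatten_pow_smooth X H : X^T = X -> H^T = H ->
  (schatten q (X + H) ^+ 2) ^+ q + (schatten q (X - H) ^+ 2) ^+ q <=
  2 * (schatten q X ^+ 2 + 4 * q%:R * schatten q H ^+ 2) ^+ q.
Proof.
move=> XT HT; have sqE (y : R) : (y ^+ 2) ^+ q = y ^+ (q + q).
  by rewrite -exprM mul2n addnn.
rewrite !sqE; apply: le_trans (schatten_two_point XT HT) _.
by apply: two_point_pow_sum; exact: schatten_ge0.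
Qed.

End Schatten.

(** * Regularity of norms built from a monotone gauge *)
Definition pow_smooth {R : realType} n (q : nat) (kappa : R) (Y : 'cV[R]_n -> R) :=
  forall x h, Y (x + h) ^+ q + Y (x - h) ^+ q <= 2 * (Y x + kappa * Y h) ^+ q.

Section CombinedGauges.
Context {R : realType} {K n : nat} (theta : 'cV[R]_K -> R).
Hypothesis gtheta : monotone_gauge theta.

Let stack (Y : 'I_K -> 'cV[R]_n -> R) (x : 'cV[R]_n) : 'cV[R]_K := \col_i Y i x.

Let stack_ge0 Y x : (forall i, square_gauge (Y i)) -> orthant (stack Y x).
Proof. by move=> gY i; rewrite mxE (square_gauge_ge0 (gY i)). Qed.

Lemma envelopeZ k a y : (0 < k)%N -> 0 <= a -> orthant y ->
  envelope theta k (a *: y) = a * envelope theta k y.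
Proof.
move=> k0 a0 y0.
have Zle b z : 0 <= b -> orthant z -> envelope theta k (b *: z) <= b * envelope theta k z.
  move=> b0 z0; have bz0 := orthantZ b0 z0.
  have := @envelope_avg _ _ theta k gtheta k0 b 0 _ _ _ _ b0 (lexx 0) bz0 bz0 z0 z0.
  have h i : (b *: z) i 0 ^+ k.+1 + (b *: z) i 0 ^+ k.+1 <=
      2 * (b * z i 0 + 0 * z i 0) ^+ k.+1.
    by rewrite !mxE mul0r addr0 mulr_natl mulr2n.
  by move=> /(_ h); lra.
apply/eqP; rewrite eq_le Zle //=; have [->|an] := eqVneq a 0.
  rewrite mul0r (le_trans _ (envelope_ge _ _ _)) ?gauge_ge0 // ?scale0r //;
    exact: orthant0.
have ap : 0 < a by rewrite lt_neqAle eq_sym an.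
rewrite -ler_pdivlMl //; apply: le_trans (Zle _ _ _ _) => //.
- by rewrite scalerA mulVf // scale1r.
- by rewrite invr_ge0.
- exact: orthantZ.
Qed.

Lemma envelope_square_gauge k Y : (0 < k)%N -> (forall i, square_gauge (Y i)) ->
  square_gauge (fun x => envelope theta k (stack Y x)).
Proof.
move=> k0 gY; have Y0 x := stack_ge0 x gY.
split=> [x|a x|a b x y a0 b0 ab].
- by apply: le_trans (envelope_ge _ gtheta _) => //; exact: gauge_ge0.
- rewrite -envelopeZ ?sqr_ge0 //; congr envelope.
  by apply/colP => i; rewrite !mxE (square_gaugeZ (gY i)).
have := @envelope_avg _ _ theta k gtheta k0 a b _ _ _ _ a0 b0
  (Y0 (a *: x + b *: y)) (Y0 (a *: x + b *: y)) (Y0 x) (Y0 y).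
have h i : stack Y (a *: x + b *: y) i 0 ^+ k.+1 +
    stack Y (a *: x + b *: y) i 0 ^+ k.+1 <=
    2 * (a * stack Y x i 0 + b * stack Y y i 0) ^+ k.+1.
  rewrite !mxE; set A := _ ^+ k.+1; have -> : A + A = 2 * A by ring.
  have y0 z : 0 <= Y i z := square_gauge_ge0 (gY i) z.
  have r0 : 0 <= a * Y i x + b * Y i y by rewrite addr_ge0 // mulr_ge0.
  by rewrite ler_wpM2l // lerXn2r ?nnegrE // (square_gauge_convex (gY i)).
by move=> /(_ h); lra.
Qed.

Lemma envelope_smooth k kappa Y : (0 < k)%N -> 0 <= kappa ->
  (forall i, square_gauge (Y i)) -> (forall i, pow_smooth k.+1 kappa (Y i)) ->
  uniformly_smooth kappa (fun x => envelope theta k (stack Y x)).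
Proof.
move=> k0 kappa0 gY sY x h; have Y0 z := stack_ge0 z gY.
rewrite -[envelope theta k (stack Y x)]mul1r.
apply: envelope_avg => // i; rewrite !mxE mul1r; exact: sY.
Qed.

(** C i x t stands for the constraint that defines the body; by monotonicity of
theta the best choice of t is the vector of the Z i x. *)
Lemma gauge_unit_ball (Z : 'I_K -> 'cV[R]_n -> R)
    (C : 'I_K -> 'cV[R]_n -> R -> Prop) :
  (forall i, square_gauge (Z i)) ->
  (forall i x t, 0 <= t -> C i x t <-> Z i x <= t) ->
  [set x | Num.sqrt (theta (stack Z x)) <= 1] =
  [set x | exists2 t, gauge_body theta t & forall i, C i x (t i 0)].
Proof.
move=> gZ CZ; have Z0 x := stack_ge0 x gZ.
have sqrt_le1 r : 0 <= r -> (Num.sqrt r <= 1) = (r <= 1 :> R).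
  by move=> r0; rewrite -[in LHS]sqrtr1 ler_sqrt.
apply/seteqP; split=> x /=; rewrite sqrt_le1 ?gauge_ge0 //.
  move=> th; exists (stack Z x) => // i; apply/CZ; first exact: Z0.
  by rewrite mxE.
move=> [t [t0 th] tC]; apply: le_trans th; apply: (gauge_monotone gtheta) => i.
by rewrite Z0 /= mxE; apply/CZ.
Qed.

(** The smooth norm is the image of the square root of the envelope of
(Y_1, .., Y_K).  The envelope lies between theta (Z) and
4 theta (2 Z) = 8 theta (Z), and sqrt 8 <= 3; the constant 8 (k + 1) is twice the
constant of pow_smooth because of uniformly_smooth_norm. *)
Lemma image_gauge_regular p (P : 'M[R]_(p, n)) k kappa
    (Z Y : 'I_K -> 'cV[R]_n -> R) :
  \rank P = p -> (0 < k)%N -> (K <= 2 ^ k.+1)%N ->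
  8 * k.+1%:R <= kappa ->
  (forall i, square_gauge (Y i)) ->
  (forall i, pow_smooth k.+1 (4 * k.+1%:R) (Y i)) ->
  (forall i x, Z i x <= Y i x <= 2 * Z i x) ->
  (forall i x, 0 <= Z i x) ->
  is_norm (fun x => Num.sqrt (theta (stack Z x))) ->
  regular_norm kappa 3 (image_norm P (fun x => Num.sqrt (theta (stack Z x)))).
Proof.
move=> rankP k0 Kk kappa_ge gY sY ZY Z_ge0 nN.
set N := fun x => _; pose M x := Num.sqrt (envelope theta k (stack Y x)).
have Y0 x := stack_ge0 x gY.
have Z0 x : orthant (stack Z x) by move=> i; rewrite mxE.
have gE := envelope_square_gauge k0 gY.
have NM x : N x <= M x.
  rewrite ler_wsqrtr // (le_trans _ (envelope_ge k gtheta _)) //.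
  apply: (gauge_monotone gtheta) => i; rewrite !mxE Z_ge0.
  by have /andP[] := ZY i x.
have MN x : M x <= 3 * N x.
  have e2 : envelope theta k (stack Y x) <= 8 * theta (stack Z x).
    apply: le_trans (envelope_le4 gtheta (Y0 x) Kk) _.
    rewrite (_ : 8 * _ = 4 * (2 * theta (stack Z x))); last by ring.
    rewrite ler_wpM2l // -(gauge_homo gtheta) //.
    apply: (gauge_monotone gtheta) => i; rewrite Y0 !mxE /=.
    by have /andP[] := ZY i x.
  rewrite -(@ler_pXn2r _ 2) ?nnegrE ?mulr_ge0 ?sqrtr_ge0 // exprMn.
  have t0 := gauge_ge0 gtheta (Z0 x).
  rewrite !sqr_sqrtr ?(square_gauge_ge0 gE) //.
  by apply: le_trans e2 _; rewrite ler_wpM2r // -natrX ler_nat.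
have nM : is_norm M.
  apply: sqrt_square_gauge_norm gE _ => x ex.
  have [_ Ndef _ _] := nN; apply: Ndef; apply/eqP.
  by rewrite eq_le sqrtr_ge0 andbT; apply: le_trans (NM x) _; rewrite /M ex sqrtr0.
have kappa4 : (0 : R) <= 4 * k.+1%:R by rewrite mulr_ge0.
have sM : uniformly_smooth (kappa / 2) (fun x => M x ^+ 2).
  move=> x h; rewrite /M !sqr_sqrtr ?(square_gauge_ge0 gE) //.
  apply: le_trans (envelope_smooth k0 kappa4 gY sY x h) _.
  rewrite ler_wpM2l // lerD2l ler_wpM2r ?(square_gauge_ge0 gE) //; lra.
have k1 : 1 <= kappa.
  apply: le_trans kappa_ge; rewrite -natrM ler1n; lia.
have e : kappa = 2 * (kappa / 2) by field.
split=> //; first by rewrite ler1n.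
  exact: image_norm_is_norm.
exists (image_norm P M).
  rewrite e; apply: uniformly_smooth_norm; last by rewrite -e.
    exact: image_norm_is_norm.
  exact: image_norm_smooth.
have [M0 _ _ _] := image_norm_is_norm rankP nM.
move=> u; split.
  rewrite ler_pdivrMl //.
  have [x [<- <- _]] := image_norm_minimizer rankP nN u.
  by apply: le_trans (MN x); exact: image_norm_le.
apply: (@le_trans _ _ (image_norm P M u)); last by rewrite ler_peMl // ler1n.
have [x [<- <- _]] := image_norm_minimizer rankP nM u.
by apply: le_trans (NM x); exact: image_norm_le.
Qed.

End CombinedGauges.

Section LogarithmicExponent.
Context {R : realType}.

Lemma half_le_ln2 : 2^-1 <= ln 2 :> R.
Proof.
have : ln (1 + (- 2^-1)) <= - 2^-1 :> R by apply: le_ln1Dx; lra.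
have -> : 1 + - 2^-1 = 2^-1 :> R by field.
by rewrite lnV ?posrE // lerN2.
Qed.

(** Take q = k + 1 = floor (log_2 m) + 2.  Then q ln 2 <= 3 L, and ln 2 >= 1/2
gives q <= 6 L. *)
Lemma log_exponent (m : nat) (L : R) : (0 < m)%N -> ln 2 <= L -> ln m%:R <= L ->
  exists k, [/\ (0 < k)%N, (m <= 2 ^ k.+1)%N & 8 * k.+1%:R <= 48 * L].
Proof.
move=> m0 L2 Lm; exists (trunc_log 2 m).+1; split=> //.
  apply: leq_trans (ltnW (trunc_log_ltn m (isT : 1 < 2)%N)) _.
  by rewrite leq_exp2l.
have h : (trunc_log 2 m)%:R * ln 2 <= ln m%:R :> R.
  rewrite mulr_natl -lnXn // ler_ln ?posrE ?exprn_gt0 ?ltr0n //.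
  by rewrite -natrX ler_nat trunc_logP.
have h2 := half_le_ln2.
have q3 : (trunc_log 2 m).+2%:R * ln 2 <= 3 * L.
  rewrite -addn2 natrD mulrDl; lra.
have : (trunc_log 2 m).+2%:R * 2^-1 <= (trunc_log 2 m).+2%:R * ln 2 :> R.
  by rewrite ler_wpM2l.
lra.
Qed.

End LogarithmicExponent.

Section LinearMatrices.
Context {R : realType} {n d : nat} (S : 'I_n -> 'M[R]_d).

Lemma linear_matrixD x y :
  linear_matrix S (x + y) = linear_matrix S x + linear_matrix S y.
Proof.
by rewrite -big_split; apply: eq_bigr => j _; rewrite mxE scalerDl.
Qed.

Lemma linear_matrixZ a x : linear_matrix S (a *: x) = a *: linear_matrix S x.
Proof.
by rewrite /linear_matrix scaler_sumr; apply: eq_bigr => j _; rewrite mxE scalerA.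
Qed.

Lemma linear_matrixB x y :
  linear_matrix S (x - y) = linear_matrix S x - linear_matrix S y.
Proof. by rewrite linear_matrixD -scaleN1r linear_matrixZ scaleN1r. Qed.

Lemma linear_matrix_sym x : (forall j, S j \is symmetricmx) ->
  (linear_matrix S x)^T = linear_matrix S x.
Proof.
move=> Ssym; rewrite /linear_matrix linear_sum; apply: eq_bigr => j _.
by rewrite linearZ /= (symmetricmxP _ (Ssym j)).
Qed.

End LinearMatrices.

Theorem theorem3p1 (R : realType) :
  exists c1 c2 : R,
  forall (K n p : nat) (theta : 'cV[R]_K -> R) (P : 'M[R]_(p, n)),
    (0 < K)%N -> monotone_gauge theta -> \rank P = p ->
    (forall T : 'I_K -> 'M[R]_n,
       (forall i, possemidef (T i)) -> posdef (\sum_i T i) ->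
       let X := basic_ellitope theta T in
       let normX := basic_ellitopic_norm theta T in
       let normPX := image_norm P normX in
       [/\ norm_with_unit_ball normX X,
           norm_with_unit_ball normPX (image_body P X),
           forall u, is_minimum (fiber_values P normX u) (normPX u)
         & regular_norm (c1 * ln K.+1%:R) c2 normPX]) /\
    (forall (d : 'I_K -> nat) (S : forall i : 'I_K, 'I_n -> 'M[R]_(d i)),
       (forall i, (0 < d i)%N) ->
       (forall i j, S i j \is symmetricmx) ->
       (forall x, (forall i, linear_matrix (S i) x = 0) <-> x = 0) ->
       let X := basic_spectratope theta S in
       let normX := basic_spectratopic_norm theta S in
       let normPX := image_norm P normX in
       [/\ norm_with_unit_ball normX X,
           norm_with_unit_ball normPX (image_body P X),
           forall u, is_minimum (fiber_values P normX u) (normPX u)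
         & regular_norm (c1 * (ln K.+1%:R + max_ln d)) c2 normPX]).
Proof.
exists 48, 3 => K n p theta P K0 gtheta rankP.
have gauge_coord0 (y : 'cV[R]_K) : orthant y -> Num.sqrt (theta y) = 0 ->
    forall i, y i 0 = 0.
  move=> y0 /eqP; rewrite sqrtr_eq0 => ty i.
  have /(gauge_eq0 gtheta y0) -> : theta y = 0.
    by apply/eqP; rewrite eq_le ty gauge_ge0.
  by rewrite mxE.
have lnK2 : ln 2 <= ln K.+1%:R :> R by rewrite ler_ln ?posrE // ler_nat.
have lnK : ln K%:R <= ln K.+1%:R :> R by rewrite ler_ln ?posrE ?ltr0n // ler_nat.
split=> [T T0 Tpos|d S d0 Ssym Sdef] X normX normPX.
(* For an ellitope the quadratic forms are smooth enough, and Y = Z. *)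
- pose Z i (x : 'cV[R]_n) := bilin (T i) x x.
  have gZ i : square_gauge (Z i) by exact: bilin_square_gauge.
  have NE : normX = fun x => Num.sqrt (theta (\col_i Z i x)).
    apply/funext => x; congr (Num.sqrt (theta _)); apply/colP => i.
    by rewrite !mxE euclidean_norm_sqrtmx.
  have nN : is_norm normX.
    rewrite NE; apply: (@sqrt_square_gauge_norm _ _ (fun x => theta (\col_i Z i x))).
      exact: square_gauge_comp.
    move=> x Zx; apply/eqP/negPn/negP => /(Tpos.2).
    have -> : (x^T *m (\sum_i T i) *m x) 0 0 = \sum_i Z i x.
      by rewrite mulmx_sumr mulmx_suml summxE.
    rewrite big1 ?ltxx // => i _.
    have := gauge_coord0 (\col_i Z i x) _ _ i; rewrite mxE; apply.
      by move=> j; rewrite mxE (square_gauge_ge0 (gZ j)).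
    by rewrite Zx sqrtr0.
  have nX : norm_with_unit_ball normX X.
    split=> //; rewrite NE.
    by rewrite (@gauge_unit_ball _ _ _ _ gtheta Z (fun i x t => bilin (T i) x x <= t)).
  split=> //.
  + exact: image_norm_unit_ball.
  + exact: image_norm_is_minimum.
  have [k [k0 Kk kappa]] := log_exponent K0 lnK2 lnK.
  rewrite /normPX NE; apply: (image_gauge_regular gtheta (k := k) (Y := Z)) => //.
  + by move=> i x h; exact: bilin_pow_smooth.
  + by move=> i x; rewrite lexx ler_peMl ?ler1n // (square_gauge_ge0 (gZ i)).
  + by move=> i x; exact: (square_gauge_ge0 (gZ i)).
  + by rewrite -NE.
- have sym i x := linear_matrix_sym x (fun j => Ssym i j).
  pose Z i (x : 'cV[R]_n) := spectral_norm (linear_matrix (S i) x) ^+ 2.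
  have gZ i : square_gauge (Z i).
    apply: seminorm_square_gauge => [x|a x|x y]; first exact: spectral_norm_ge0.
      by rewrite linear_matrixZ spectral_normZ.
    by rewrite linear_matrixD spectral_normD.
  have nN : is_norm normX.
    apply: (@sqrt_square_gauge_norm _ _ (fun x => theta (\col_i Z i x))).
      exact: square_gauge_comp.
    move=> x Zx; apply/Sdef => i; apply: spectral_norm_eq0 => //.
    apply/eqP; rewrite -sqrf_eq0; apply/eqP.
    have := gauge_coord0 (\col_i Z i x) _ _ i; rewrite mxE; apply.
      by move=> j; rewrite mxE (square_gauge_ge0 (gZ j)).
    by rewrite Zx sqrtr0.
  have nX : norm_with_unit_ball normX X.
    split=> //; apply: (gauge_unit_ball (Z := Z) (C := fun i x t => loewner_le
      (linear_matrix (S i) x *m linear_matrix (S i) x) t%:M) gtheta gZ).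
    by move=> i x t t0; exact: loewner_le_scalar.
  split=> //.
  + exact: image_norm_unit_ball.
  + exact: image_norm_is_minimum.
  have max_ln0 : 0 <= max_ln d :> R by exact: bigmax_ge_id.
  have max_ln_ge i : ln (d i)%:R <= max_ln d :> R.
    exact: (le_bigmax _ (fun i => ln (d i)%:R)).
  (* The same exponent has to absorb the number K of blocks and their sizes. *)
  pose m := maxn K (\max_i d i).
  have m0 : (0 < m)%N by rewrite leq_max K0.
  have lnm : ln m%:R <= ln K.+1%:R + max_ln d :> R.
    rewrite /m /maxn; case: ifP => _; last by rewrite ler_wpDr.
    have [i ->] : {i | \max_i d i = d i} by apply: bigop.eq_bigmax; rewrite card_ord.
    by rewrite ler_wpDl // (le_trans _ lnK2) // ln_ge0 // ler1n.
  have ln2m : ln 2 <= ln K.+1%:R + max_ln d :> R by rewrite ler_wpDr.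
  have [k [k0 mk kappa]] := log_exponent m0 ln2m lnm.
  have Kk : (K <= 2 ^ k.+1)%N by apply: leq_trans mk; exact: leq_maxl.
  have dk i : (d i <= 2 ^ k.+1)%N.
    by apply: leq_trans mk; rewrite leq_max leq_bigmax orbT.
  pose Y i (x : 'cV[R]_n) := schatten k.+1 (linear_matrix (S i) x) ^+ 2.
  apply: (image_gauge_regular gtheta (k := k) (Z := Z) (Y := Y)) => //.
  + move=> i; apply: seminorm_square_gauge => [x|a x|x y]; first exact: schatten_ge0.
      by rewrite linear_matrixZ schattenZ.
    by rewrite linear_matrixD schattenD.
  + move=> i x h; rewrite /Y linear_matrixB linear_matrixD.
    exact: schatten_pow_smooth.
  + move=> i x; rewrite /Z /Y schatten_le_spectral_norm // andbT.
    by rewrite lerXn2r ?nnegrE ?spectral_norm_ge0 ?schatten_ge0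
      // spectral_norm_le_schatten.
  + by move=> i x; exact: sqr_ge0.
Qed.
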